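(* Let $K$ be an uncountable compact metric space with at most finitely many isolated points and let $d\in \mathbb{N}^+$. Then for a prevalent $f\in C(K,\mathbb{R}^d)$ we have \[ \underline{\dim}_B\operatorname{graph}(f)=\underline{\dim}_B K+d \quad\text{and}\quad \overline{\dim}_B \operatorname{graph}(f)=\overline{\dim}_B K+d. \]
   Context: $C(K,\mathbb{R}^d)$ is the Banach space of continuous maps $K\to\mathbb{R}^d$ with the maximum (supremum) norm, regarded as an abelian Polish group under addition. A set $A\subset G$ in an abelian Polish group $G$ is shy (Haar null) if there exist a Borel set $B\supset A$ and a Borel probability measure $\mu$ on $G$ with $\mu(B+x)=0$ for all $x\in G$; a set is prevalent if its complement is shy; ''for a prevalent $f$ property P holds'' means the set of $f$ with property P contains a prevalent set. For a metric space $(X,\rho)$, $X\times\mathbb{R}^d$ carries the metric $\sqrt{\rho(x_1,x_2)^2+|z_1-z_2|^2}$, and $\operatorname{graph}(f)=\{(x,f(x)):x\in K\}\subset K\times\mathbb{R}^d$. A set $S$ is a $\delta$-packing if $\rho(x,z)>\delta$ for all distinct $x,z\in S$; $N_n(X)$ is the maximal cardinality of a $2^{-n}$-packing in $X$. For non-empty totally bounded $X$, $\underline{\dim}_B X=\liminf_{n} \frac{\log N_n(X)}{n\log 2}$ and $\overline{\dim}_B X=\limsup_n \frac{\log N_n(X)}{n\log 2}$. *)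

(* Defs.v *)
From Stdlib Require Import Reals Lra List.
Open Scope R_scope.

Record MetricSpace := {
  carrier :> Type;
  mdist : carrier -> carrier -> R;
  dist_eq0 : forall x y, mdist x y = 0 <-> x = y;
  dist_sym : forall x y, mdist x y = mdist y x;
  dist_tri : forall x y z, mdist x z <= mdist x y + mdist y z
}.

(** (sequential) compactness; equivalent to compactness for metric spaces *)
Definition compact_space (K : MetricSpace) : Prop :=
  forall u : nat -> K, exists (phi : nat -> nat) (x : K),
    (forall n, (phi n < phi (S n))%nat) /\
    forall eps, eps > 0 -> exists N, forall n, (n >= N)%nat -> mdist K (u (phi n)) x < eps.

Definition countable_type (T : Type) : Prop :=
  exists g : T -> nat, forall x y, g x = g y -> x = y.

Definition uncountable_space (K : MetricSpace) : Prop := ~ countable_type K.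

Definition isolated (K : MetricSpace) (x : K) : Prop :=
  exists r, r > 0 /\ forall y : K, mdist K x y < r -> y = x.

Definition finitely_many_isolated (K : MetricSpace) : Prop :=
  exists l : list K, forall x : K, isolated K x -> In x l.

(** * R^d : vectors are [nat -> R], only coordinates [< d] matter *)
Fixpoint sumsq (d : nat) (z : nat -> R) : R :=
  match d with O => 0 | S n => sumsq n z + z n ^ 2 end.

Definition eucl (d : nat) (z : nat -> R) : R := sqrt (sumsq d z).

Definition vsub (z w : nat -> R) : nat -> R := fun i => z i - w i.

Definition inC (K : MetricSpace) (d : nat) (f : K -> nat -> R) : Prop :=
  (forall x i, (d <= i)%nat -> f x i = 0) /\
  (forall x eps, eps > 0 -> exists delta, delta > 0 /\
     forall y, mdist K x y < delta -> eucl d (vsub (f x) (f y)) < eps).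

Definition fsub {K : MetricSpace} (f g : K -> nat -> R) : K -> nat -> R :=
  fun x i => f x i - g x i.

(** open sets for the supremum norm (relative to C(K,R^d)); since K is compact,
    the open sup-ball of radius r around f contains the set of g with
    |f x - g x| <= r' for all x, for any r' < r, so this is the sup-norm topology *)
Definition supopen (K : MetricSpace) (d : nat) (U : (K -> nat -> R) -> Prop) : Prop :=
  forall f, inC K d f -> U f -> exists r, r > 0 /\
    forall g, inC K d g -> (forall x, eucl d (vsub (f x) (g x)) <= r) -> U g.

(** Borel subsets of C(K,R^d) (sets considered up to their trace on C(K,R^d)) *)
Inductive borel (K : MetricSpace) (d : nat) : ((K -> nat -> R) -> Prop) -> Prop :=
| borel_open : forall U, supopen K d U -> borel K d U
| borel_compl : forall B, borel K d B -> borel K d (fun f => ~ B f)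
| borel_union : forall Bs : nat -> (K -> nat -> R) -> Prop,
    (forall n, borel K d (Bs n)) -> borel K d (fun f => exists n, Bs n f)
| borel_ext : forall B B', borel K d B ->
    (forall f, inC K d f -> (B f <-> B' f)) -> borel K d B'.

Definition borel_prob_measure (K : MetricSpace) (d : nat)
  (mu : ((K -> nat -> R) -> Prop) -> R) : Prop :=
  (forall B B', borel K d B -> (forall f, inC K d f -> (B f <-> B' f)) -> mu B = mu B') /\
  (forall B, borel K d B -> 0 <= mu B) /\
  mu (fun _ => True) = 1 /\
  (forall Bs : nat -> (K -> nat -> R) -> Prop,
     (forall n, borel K d (Bs n)) ->
     (forall i j f, i <> j -> inC K d f -> Bs i f -> Bs j f -> False) ->
     infinite_sum (fun n => mu (Bs n)) (mu (fun f => exists n, Bs n f))).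

Definition translate {K : MetricSpace} (B : (K -> nat -> R) -> Prop) (x : K -> nat -> R)
  : (K -> nat -> R) -> Prop := fun y => B (fsub y x).

Definition shy (K : MetricSpace) (d : nat) (A : (K -> nat -> R) -> Prop) : Prop :=
  exists (B : (K -> nat -> R) -> Prop) (mu : ((K -> nat -> R) -> Prop) -> R),
    borel K d B /\ (forall f, inC K d f -> A f -> B f) /\
    borel_prob_measure K d mu /\
    forall x, inC K d x -> mu (translate B x) = 0.

Definition prevalent (K : MetricSpace) (d : nat) (S : (K -> nat -> R) -> Prop) : Prop :=
  shy K d (fun f => inC K d f /\ ~ S f).

Definition prevalently (K : MetricSpace) (d : nat) (P : (K -> nat -> R) -> Prop) : Prop :=
  exists S, prevalent K d S /\ forall f, inC K d f -> S f -> P f.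

Definition is_packing {T : Type} (dT : T -> T -> R) (X : T -> Prop) (delta : R)
  (l : list T) (x0 : T) : Prop :=
  (forall p, In p l -> X p) /\
  (forall i j, (i < j < length l)%nat -> dT (nth i l x0) (nth j l x0) > delta).

Definition is_packing_number {T : Type} (dT : T -> T -> R) (X : T -> Prop)
  (n m : nat) : Prop :=
  (exists l x0, is_packing dT X (/ 2 ^ n) l x0 /\ length l = m) /\
  (forall l x0, is_packing dT X (/ 2 ^ n) l x0 -> (length l <= m)%nat).

Inductive Rbar := Fin (r : R) | PInf.

Definition Rbar_plus_nat (a : Rbar) (d : nat) : Rbar :=
  match a with Fin r => Fin (r + INR d) | PInf => PInf end.

Definition is_liminf (a : nat -> R) (l : Rbar) : Prop :=
  match l with
  | Fin l => forall eps, eps > 0 ->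
      (exists N, forall n, (n >= N)%nat -> a n > l - eps) /\
      (forall N, exists n, (n >= N)%nat /\ a n < l + eps)
  | PInf => forall M, exists N, forall n, (n >= N)%nat -> a n > M
  end.

Definition is_limsup (a : nat -> R) (l : Rbar) : Prop :=
  match l with
  | Fin l => forall eps, eps > 0 ->
      (exists N, forall n, (n >= N)%nat -> a n < l + eps) /\
      (forall N, exists n, (n >= N)%nat /\ a n > l - eps)
  | PInf => forall M N, exists n, (n >= N)%nat /\ a n > M
  end.

Definition box_ratio (N : nat -> nat) : nat -> R :=
  fun n => ln (INR (N n)) / (INR n * ln 2).

Definition lower_box_dim {T : Type} (dT : T -> T -> R) (X : T -> Prop) (v : Rbar) : Prop :=
  exists N : nat -> nat, (forall n, is_packing_number dT X n (N n)) /\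
    is_liminf (box_ratio N) v.

Definition upper_box_dim {T : Type} (dT : T -> T -> R) (X : T -> Prop) (v : Rbar) : Prop :=
  exists N : nat -> nat, (forall n, is_packing_number dT X n (N n)) /\
    is_limsup (box_ratio N) v.

Definition prod_dist (K : MetricSpace) (d : nat) (p q : K * (nat -> R)) : R :=
  sqrt (mdist K (fst p) (fst q) ^ 2 + eucl d (vsub (snd p) (snd q)) ^ 2).

Definition graph {K : MetricSpace} (f : K -> nat -> R) : K * (nat -> R) -> Prop :=
  fun p => snd p = f (fst p).

(* Main.v *)
Require Import Defs.
From Stdlib Require Import Reals Lra Lia List Arith Wf_nat FinFun ZArith.
From Stdlib Require Import Classical ClassicalEpsilon FunctionalExtensionality PropExtensionality.
From mathcomp Require all_boot all_order all_algebra all_classical all_reals all_analysis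
  measurable_realfun Rstruct Rstruct_topology.
Import ListNotations.
Open Scope R_scope.

(** The upper bounds hold for every [f], since its graph lies in [K] times a cube.  For the
    lower bounds the probe is the [d]-parameter family [t |-> (t_0 g_0, ..., t_{d-1} g_{d-1})],
    [t] uniform in [[0,1]^d], for one carefully chosen [g] in [C(K,R^d)].  At scale [2^-n], next to
    each non-isolated point of a maximal [2^-n]-packing of [K], [g] maps a tiny cluster of
    [m_n^d] points onto a grid of mesh [s_n], up to an error [s_n / 2], where [m_n] is [2^n] up to a
    factor polynomial in [n]; [g] is a uniform limit, each stage being corrected by continuous
    functions that vanish at the points used before.

    For any fixed [f], two points of a cluster have images under [f + t g] within [2^-(n+1)] in all
    coordinates with probability at most the product of [4 2^-(n+1) / (s_n |j_k - j'_k|)] over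
    the [k] with [j_k <> j'_k].  Summing (harmonic sums) and using Markov's inequality, with
    probability [1 - O(n^-2)] the number of close pairs is at most half the number of points; dropping
    one point of every close pair leaves a [2^-(n+1)]-packing of the graph with at least
    [#packing * m_n^d / 2] points.  Borel-Cantelli gives this for all large [n], almost surely. *)

(** * Probability spaces *)

(** Nothing is assumed about the translate [f], so the randomness of [t] alone must separate graph
    points: along the probe each coordinate difference is affine in [t k], and [f] only moves the
    centre of the interval on which it is small. The failure bound must not involve the number of
    clusters, because the packing numbers of [K] may grow at any rate; comparing close pairs with
    points, cluster by cluster, achieves this. The polynomial loss in [m_n] comes from two opposing
    demands. The mesh [s_n] has to exceed [2^-n] by enough to absorb a harmonic sum of order [n] and
    still leave a summable failure probability; the height [m_n s_n] has to be summable for [g] to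
    converge uniformly. A polynomial factor disappears in [log m_n / (n log 2)]. Measurability of
    the box dimension in [f] is never discussed: the exceptional set is covered by the functions
    that fail to be [scattered] at infinitely many scales, a Borel set because [scattered] is an
    open condition. Finitely many isolated points cost a bounded factor in the packing numbers. *)

(** A bare interface over Stdlib reals, so that the probabilistic arguments do not depend on how the
    measure is built; [UniformProbe] supplies the instance. *)
Record prob_space := {
  sample :> Type;
  event : (sample -> Prop) -> Prop;
  pr : (sample -> Prop) -> R;
  event_full : event (fun _ => True);
  event_compl : forall A, event A -> event (fun w => ~ A w);
  event_union : forall A : nat -> sample -> Prop,
    (forall n, event (A n)) -> event (fun w => exists n, A n w);
  pr_ge0 : forall A, event A -> 0 <= pr A;
  pr_full : pr (fun _ => True) = 1;
  pr_sigma : forall A : nat -> sample -> Prop, (forall n, event (A n)) ->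
    (forall i j w, i <> j -> A i w -> A j w -> False) ->
    infinite_sum (fun n => pr (A n)) (pr (fun w => exists n, A n w))
}.

Fixpoint prodR (n : nat) (f : nat -> R) : R :=
  match n with O => 1 | S n => prodR n f * f n end.

Lemma pred_ext {T : Type} (A B : T -> Prop) : (forall w, A w <-> B w) -> A = B.
Proof.
  intros H. apply functional_extensionality; intros w.
  apply propositional_extensionality, H.
Qed.

Lemma event_iff (O : prob_space) (A B : O -> Prop) :
  (forall w, A w <-> B w) -> event O A -> event O B.
Proof. intros H HA. now rewrite <- (pred_ext A B H). Qed.

Lemma event_empty (O : prob_space) : event O (fun _ => False).
Proof.
  apply (event_iff O (fun _ => ~ True)); [tauto|].
  apply event_compl, event_full.
Qed.

Lemma event_const (O : prob_space) (Q : Prop) : event O (fun _ => Q).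
Proof.
  destruct (classic Q).
  - apply (event_iff O (fun _ => True)); [tauto|]. apply event_full.
  - apply (event_iff O (fun _ => False)); [tauto|]. apply event_empty.
Qed.

Lemma event_or (O : prob_space) (A B : O -> Prop) :
  event O A -> event O B -> event O (fun w => A w \/ B w).
Proof.
  intros HA HB.
  apply (event_iff O (fun w => exists n : nat, match n with 0%nat => A | _ => B end w)).
  - intros w; split.
    + intros [[|n] H]; auto.
    + intros [H|H]; [now exists 0%nat | now exists 1%nat].
  - apply event_union; intros [|n]; auto.
Qed.

Lemma event_and (O : prob_space) (A B : O -> Prop) :
  event O A -> event O B -> event O (fun w => A w /\ B w).
Proof.
  intros HA HB.
  apply (event_iff O (fun w => ~ (~ A w \/ ~ B w))).
  - intros w; tauto.
  - apply event_compl, event_or; now apply event_compl.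
Qed.

Lemma event_inter (O : prob_space) (A : nat -> O -> Prop) :
  (forall n, event O (A n)) -> event O (fun w => forall n, A n w).
Proof.
  intros HA.
  apply (event_iff O (fun w => ~ exists n, ~ A n w)).
  - intros w; split; intros H.
    + intros n. apply NNPP; intros Hn. apply H; now exists n.
    + intros [n Hn]; auto.
  - apply event_compl, event_union; intros n; now apply event_compl.
Qed.

Lemma event_impl (O : prob_space) (Q : Prop) (A : O -> Prop) :
  (Q -> event O A) -> event O (fun w => Q -> A w).
Proof.
  intros HA. destruct (classic Q) as [q|nq].
  - apply (event_iff O A); [tauto|auto].
  - apply (event_iff O (fun _ => True)); [tauto|apply event_full].
Qed.

(** Countably many copies of the empty event are disjoint, so the series with constant term [p]
    converges to [p], which excludes [p > 0]. *)
Lemma pr_empty (O : prob_space) : pr O (fun _ => False) = 0.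
Proof.
  set (A := fun (n : nat) (w : O) => False).
  assert (H : infinite_sum (fun n => pr O (A n)) (pr O (fun w => exists n, A n w))).
  { apply pr_sigma; [intros n; apply event_empty|]. intros i j w _ []. }
  rewrite (pred_ext (fun w => exists n, A n w) (fun _ => False)) in H
    by (intros w; split; [intros [n []]|tauto]).
  unfold A in H. set (p := pr O (fun _ => False)) in *.
  assert (Hp : 0 <= p) by apply pr_ge0, event_empty.
  apply NNPP; intros Hne.
  destruct (H (p / 2)) as [N HN]; [lra|].
  specialize (HN (S N) ltac:(lia)).
  rewrite sum_cte in HN. unfold Rdist in HN.
  apply Rabs_def2 in HN. rewrite !S_INR in HN.
  pose proof (pos_INR N). nra.
Qed.

Lemma pr_add (O : prob_space) (A B : O -> Prop) :
  event O A -> event O B -> (forall w, A w -> B w -> False) ->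
  pr O (fun w => A w \/ B w) = pr O A + pr O B.
Proof.
  intros HA HB Hd.
  set (D := fun n : nat => match n with 0%nat => A | 1%nat => B | _ => fun _ => False end).
  assert (H : infinite_sum (fun n => pr O (D n)) (pr O (fun w => exists n, D n w))).
  { apply pr_sigma.
    - intros [|[|n]]; cbn; auto using event_empty.
    - intros [|[|i]] [|[|j]] w Hij; cbn; intros; try tauto; try lia; eauto. }
  rewrite (pred_ext (fun w => exists n, D n w) (fun w => A w \/ B w)) in H.
  2:{ intros w; split.
      - intros [[|[|n]] Hn]; cbn in Hn; tauto.
      - intros [Ha|Hb]; [now exists 0%nat|now exists 1%nat]. }
  apply (UL_sequence (sum_f_R0 (fun n => pr O (D n)))).
  - intros e He. destruct (H e He) as [N HN]. exists N; intros n Hn. now apply HN.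
  - intros e He. exists 1%nat; intros n Hn.
    assert (E : sum_f_R0 (fun n => pr O (D n)) n = pr O A + pr O B).
    { clear -Hn. induction n as [|n IH]; [lia|].
      destruct n as [|n]; [reflexivity|].
      rewrite tech5, IH by lia. cbn [D]. rewrite pr_empty. ring. }
    rewrite E, (proj2 (Rdist_refl _ _) eq_refl). exact He.
Qed.

Lemma pr_split (O : prob_space) (A E : O -> Prop) :
  event O A -> event O E ->
  pr O A = pr O (fun w => A w /\ E w) + pr O (fun w => A w /\ ~ E w).
Proof.
  intros HA HE. rewrite <- pr_add.
  - f_equal; apply pred_ext; intros w. destruct (classic (E w)); tauto.
  - now apply event_and.
  - apply event_and; [|apply event_compl]; auto.
  - tauto.
Qed.

Lemma pr_mono (O : prob_space) (A B : O -> Prop) :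
  event O A -> event O B -> (forall w, A w -> B w) -> pr O A <= pr O B.
Proof.
  intros HA HB H. rewrite (pr_split O B A HB HA).
  rewrite (pred_ext (fun w => B w /\ A w) A) by firstorder.
  assert (0 <= pr O (fun w => B w /\ ~ A w)); [|lra].
  apply pr_ge0, event_and; [|apply event_compl]; auto.
Qed.

(** The terms telescope, [1/((k+1)(k+2)) = 1/(k+1) - 1/(k+2)]; this is why that sequence, and not
    [1/n^2], serves as the summable bound throughout. The induction runs on the sharper form [G],
    which keeps the tail. *)
Lemma sum_f_R0_le_inv_telescope (u : nat -> R) (C : R) (N n : nat) :
  (forall k, u k <= C / ((INR (N + k) + 1) * (INR (N + k) + 2))) -> 0 <= C ->
  sum_f_R0 u n <= C / (INR N + 1).
Proof.
  intros Hu HC.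
  assert (G : sum_f_R0 u n <= C / (INR N + 1) - C / (INR (N + n) + 2)).
  { induction n as [|n IH]; cbn [sum_f_R0].
    - eapply Rle_trans; [apply Hu|]. rewrite Nat.add_0_r.
      pose proof (pos_INR N). right; field; lra.
    - eapply Rle_trans; [apply Rplus_le_compat; [exact IH|apply Hu]|].
      rewrite Nat.add_succ_r, S_INR. pose proof (pos_INR (N + n)); pose proof (pos_INR N).
      right; field; lra. }
  assert (0 <= C / (INR (N + n) + 2)); [|lra].
  apply Rmult_le_pos; [lra|]. pose proof (pos_INR (N + n)).
  left; apply Rinv_0_lt_compat; lra.
Qed.

(** The events are made disjoint by the first index at which they occur, so sigma-additivity
    applies; every partial sum then stays below the telescoped bound. *)
Lemma pr_tail_union (O : prob_space) (A : nat -> O -> Prop) (C : R) (N : nat) :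
  0 <= C -> (forall n, event O (A n)) ->
  (forall n, pr O (A n) <= C / ((INR n + 1) * (INR n + 2))) ->
  pr O (fun w => exists n, (N <= n)%nat /\ A n w) <= C / (INR N + 1).
Proof.
  intros HC HA Hp.
  set (D := fun (n : nat) (w : O) => A (N + n)%nat w /\
              ~ exists k, (k < n)%nat /\ A (N + k)%nat w).
  assert (HD : forall n, event O (D n)).
  { intros n. apply event_and; [apply HA|]. apply event_compl, event_union; intros k.
    apply event_and; [apply event_const|apply HA]. }
  assert (H : infinite_sum (fun n => pr O (D n)) (pr O (fun w => exists n, D n w))).
  { apply pr_sigma; [exact HD|]. intros i j w Hij [H1 H2] [H3 H4].
    destruct (Nat.lt_ge_cases i j) as [l|l].
    - apply H4; exists i; auto.
    - apply H2; exists j; split; [lia|auto]. }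
  rewrite (pred_ext (fun w => exists n, (N <= n)%nat /\ A n w) (fun w => exists n, D n w)).
  2:{ intros w; split.
      - intros [n [Hn Hw]]. replace n with (N + (n - N))%nat in Hw by lia.
        remember (n - N)%nat as m eqn:Em; clear Em.
        induction m as [m IH] using (well_founded_induction lt_wf).
        destruct (classic (exists k, (k < m)%nat /\ A (N + k)%nat w)) as [[k [Hk Hk']]|Hno].
        + now apply (IH k).
        + exists m; split; auto.
      - intros [n [Hn _]]; exists (N + n)%nat; split; [lia|auto]. }
  apply Rnot_lt_le; intros Hlt.
  destruct (H (pr O (fun w => exists n, D n w) - C / (INR N + 1))) as [M HM]; [lra|].
  specialize (HM M ltac:(lia)). unfold Rdist in HM. apply Rabs_def2 in HM.
  assert (sum_f_R0 (fun n => pr O (D n)) M <= C / (INR N + 1)); [|lra].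
  apply sum_f_R0_le_inv_telescope; [|exact HC]. intros k.
  eapply Rle_trans; [|apply Hp]. apply pr_mono; [apply HD|apply HA|]. now intros w [].
Qed.

(** First Borel-Cantelli lemma: the event lies in every tail union, whose probability is at most
    [C / (N + 1)]. *)
Lemma pr_infinitely_often (O : prob_space) (A : nat -> O -> Prop) (C : R) :
  0 <= C -> (forall n, event O (A n)) ->
  (forall n, pr O (A n) <= C / ((INR n + 1) * (INR n + 2))) ->
  pr O (fun w => forall N, exists n, (N <= n)%nat /\ A n w) = 0.
Proof.
  intros HC HA Hp.
  assert (HU : forall N, event O (fun w => exists n, (N <= n)%nat /\ A n w)).
  { intros N. apply event_union; intros n. apply event_and; [apply event_const|apply HA]. }
  pose proof (event_inter O _ HU) as HI.
  set (p := pr O (fun w => forall N, exists n, (N <= n)%nat /\ A n w)).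
  assert (H0 : 0 <= p) by now apply pr_ge0.
  assert (HN : forall N, p <= C / (INR N + 1)).
  { intros N. eapply Rle_trans; [|now apply pr_tail_union].
    apply pr_mono; auto. }
  apply NNPP; intros Hne.
  destruct (INR_unbounded (C / p)) as [N Hlt].
  specialize (HN N). pose proof (pos_INR N).
  apply (Rmult_lt_compat_r p) in Hlt; [|lra].
  apply (Rmult_le_compat_r (INR N + 1)) in HN; [|lra].
  unfold Rdiv in *. rewrite Rmult_assoc, Rinv_l in Hlt by lra.
  rewrite Rmult_assoc, Rinv_l in HN by lra. nra.
Qed.

(** * Counting the events that occur, and Markov's inequality *)

Definition count {A : Type} (E : A -> Prop) (l : list A) : nat :=
  length (filter (fun a => if excluded_middle_informative (E a) then true else false) l).

Lemma count_cons_true {A : Type} (E : A -> Prop) (a : A) (l : list A) :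
  E a -> count E (a :: l) = S (count E l).
Proof.
  intros H. unfold count; cbn. destruct (excluded_middle_informative (E a)); tauto.
Qed.

Lemma count_cons_false {A : Type} (E : A -> Prop) (a : A) (l : list A) :
  ~ E a -> count E (a :: l) = count E l.
Proof.
  intros H. unfold count; cbn. destruct (excluded_middle_informative (E a)); tauto.
Qed.

Lemma count_le {A : Type} (E F : A -> Prop) (l : list A) :
  (forall a, In a l -> E a -> F a) -> (count E l <= count F l)%nat.
Proof.
  induction l as [|a l IH]; intros H; [apply le_n|].
  assert (H' : (count E l <= count F l)%nat) by (apply IH; intros; apply H; cbn; auto).
  destruct (classic (E a)) as [e|e].
  - rewrite !count_cons_true; [lia| |auto]. apply H; cbn; auto.
  - rewrite (count_cons_false E) by auto.
    destruct (classic (F a)); [rewrite count_cons_true|rewrite count_cons_false]; auto.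
Qed.

Lemma count_app {A : Type} (E : A -> Prop) (l l' : list A) :
  count E (l ++ l') = (count E l + count E l')%nat.
Proof. unfold count. now rewrite filter_app, length_app. Qed.

Definition sum_list {A : Type} (u : A -> R) (l : list A) : R :=
  fold_right (fun a s => u a + s) 0 l.

Lemma event_count (O : prob_space) {A : Type} (E : A -> O -> Prop) (l : list A) (k : nat) :
  (forall a, event O (E a)) -> event O (fun w => (k <= count (fun a => E a w) l)%nat).
Proof.
  intros HE. revert k. induction l as [|a l IH]; intros k; [exact (event_const O (k <= 0)%nat)|].
  apply (event_iff O (fun w => (E a w /\ (k <= S (count (fun a => E a w) l))%nat) \/
                               (~ E a w /\ (k <= count (fun a => E a w) l)%nat))).
  - intros w. destruct (classic (E a w)) as [e|e].
    + rewrite count_cons_true by exact e. tauto.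
    + rewrite count_cons_false by exact e. tauto.
  - apply event_or; apply event_and; try apply event_compl; auto.
    (* Truncated subtraction makes this correct for [k = 0] as well. *)
    apply (event_iff O (fun w => (k - 1 <= count (fun a => E a w) l)%nat)); [lia|apply IH].
Qed.

(* Markov's inequality; the induction splits along the first event, hence the restriction to [B]. *)
Lemma pr_count_ge (O : prob_space) {A : Type} (E : A -> O -> Prop) (l : list A)
  (B : O -> Prop) (k : nat) :
  (forall a, event O (E a)) -> event O B ->
  INR k * pr O (fun w => B w /\ (k <= count (fun a => E a w) l)%nat)
  <= sum_list (fun a => pr O (fun w => B w /\ E a w)) l.
Proof.
  intros HE. revert B k. induction l as [|a l IH]; intros B k HB.
  - cbn. destruct k as [|k]; [cbn; lra|].
    rewrite (pred_ext (fun w => B w /\ (S k <= 0)%nat) (fun _ => False)) by (intros; lia).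
    rewrite pr_empty; lra.
  - cbn [sum_list fold_right]. fold (sum_list (fun a => pr O (fun w => B w /\ E a w)) l).
    destruct k as [|k].
    { cbn [INR]. rewrite Rmult_0_l. apply Rplus_le_le_0_compat.
      - apply pr_ge0, event_and; auto.
      - clear IH. induction l as [|b l IHl]; cbn; [lra|].
        apply Rplus_le_le_0_compat; [apply pr_ge0, event_and; auto|exact IHl]. }
    set (B1 := fun w => B w /\ E a w). set (B2 := fun w => B w /\ ~ E a w).
    assert (HB1 : event O B1) by (apply event_and; auto).
    assert (HB2 : event O B2) by (apply event_and; [|apply event_compl]; auto).
    assert (HS : event O (fun w => B w /\ (S k <= count (fun a => E a w) (a :: l))%nat)).
    { apply event_and; [auto|]. now apply (event_count O E). }
    rewrite (pr_split O _ (E a) HS (HE a)).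
    rewrite (pred_ext (fun w => (B w /\ (S k <= count (fun a => E a w) (a :: l))%nat) /\ E a w)
               (fun w => B1 w /\ (k <= count (fun a => E a w) l)%nat)).
    2:{ intros w; unfold B1. destruct (classic (E a w)) as [e|e]; [|tauto].
        rewrite count_cons_true by exact e. assert (forall x y, (S x <= S y <-> x <= y)%nat) by lia.
        rewrite H. tauto. }
    rewrite (pred_ext (fun w => (B w /\ (S k <= count (fun a => E a w) (a :: l))%nat) /\ ~ E a w)
               (fun w => B2 w /\ (S k <= count (fun a => E a w) l)%nat)).
    2:{ intros w; unfold B2. destruct (classic (E a w)) as [e|e]; [tauto|].
        rewrite count_cons_false by exact e. tauto. }
    pose proof (IH B1 k HB1) as I1. pose proof (IH B2 (S k) HB2) as I2.
    assert (I3 : pr O (fun w => B1 w /\ (k <= count (fun a => E a w) l)%nat) <= pr O B1).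
    { apply pr_mono; auto; [|tauto]. apply event_and; auto. now apply (event_count O E). }
    assert (I4 : sum_list (fun b => pr O (fun w => B1 w /\ E b w)) l
               + sum_list (fun b => pr O (fun w => B2 w /\ E b w)) l
               = sum_list (fun b => pr O (fun w => B w /\ E b w)) l).
    { clear -HE HB. unfold sum_list. induction l as [|b l IHl]; cbn; [lra|].
      rewrite <- IHl, (pr_split O (fun w => B w /\ E b w) (E a)) by (try apply event_and; auto).
      rewrite (pred_ext (fun w => (B w /\ E b w) /\ E a w) (fun w => B1 w /\ E b w)) by (unfold B1; tauto).
      rewrite (pred_ext (fun w => (B w /\ E b w) /\ ~ E a w) (fun w => B2 w /\ E b w)) by (unfold B2; tauto).
      ring. }
    rewrite S_INR in *. nra.
Qed.

(** * Finite sums, packings and metric preliminaries *)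

Lemma sum_list_cons {A : Type} (u : A -> R) (a : A) (l : list A) :
  sum_list u (a :: l) = u a + sum_list u l.
Proof. reflexivity. Qed.

Lemma sum_list_le {A : Type} (u v : A -> R) (l : list A) :
  (forall a, In a l -> u a <= v a) -> sum_list u l <= sum_list v l.
Proof.
  induction l as [|a l IH]; cbn; intros H; [lra|].
  apply Rplus_le_compat; [apply H|apply IH]; auto.
Qed.

Lemma sum_list_ext {A : Type} (u v : A -> R) (l : list A) :
  (forall a, In a l -> u a = v a) -> sum_list u l = sum_list v l.
Proof.
  intros H. apply Rle_antisym; apply sum_list_le; intros a Ha; rewrite (H a Ha); apply Rle_refl.
Qed.

Lemma sum_list_app {A : Type} (u : A -> R) (l l' : list A) :
  sum_list u (l ++ l') = sum_list u l + sum_list u l'.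
Proof. induction l as [|a l IH]; [unfold sum_list; cbn; ring|]. cbn [app map]. rewrite ?sum_list_cons, IH; ring. Qed.

Lemma sum_list_map {A B : Type} (u : B -> R) (g : A -> B) (l : list A) :
  sum_list u (map g l) = sum_list (fun a => u (g a)) l.
Proof. induction l as [|a l IH]; [unfold sum_list; cbn; ring|]. cbn [app map]. rewrite ?sum_list_cons, IH; ring. Qed.

Lemma sum_list_scal {A : Type} (u : A -> R) (c : R) (l : list A) :
  sum_list (fun a => c * u a) l = c * sum_list u l.
Proof. induction l as [|a l IH]; [unfold sum_list; cbn; ring|]. cbn [app map]. rewrite ?sum_list_cons, IH; ring. Qed.

Lemma sum_list_const {A : Type} (c : R) (l : list A) :
  sum_list (fun _ => c) l = INR (length l) * c.
Proof.
  induction l as [|a l IH]; [cbn; lra|].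
  cbn [length]. rewrite sum_list_cons, IH, S_INR; lra.
Qed.

Lemma sum_list_ge0 {A : Type} (u : A -> R) (l : list A) :
  (forall a, In a l -> 0 <= u a) -> 0 <= sum_list u l.
Proof.
  intros H. eapply Rle_trans; [|apply (sum_list_le (fun _ => 0) u l H)].
  rewrite sum_list_const; lra.
Qed.

Fixpoint pairs {A : Type} (l : list A) : list (A * A) :=
  match l with [] => [] | a :: l => map (pair a) l ++ pairs l end.

Lemma In_pairs {A : Type} (l : list A) (a b : A) :
  In (a, b) (pairs l) -> In a l /\ In b l.
Proof.
  induction l as [|c l IH]; cbn; [tauto|]. rewrite in_app_iff, in_map_iff.
  intros [[x [E Hx]]|H]; [inversion E; subst; auto|]. destruct (IH H); auto.
Qed.

(** Each unordered pair is found in the row of its first element; the reversed pairs are extra and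
    nonnegative. The diagonal has to be taken off: [close_weight] is 1 there and would contribute as
    much as the number of points. *)
Lemma sum_pairs_le {A : Type} (W : A -> A -> R) (l : list A) :
  (forall a b, 0 <= W a b) ->
  sum_list (fun p => W (fst p) (snd p)) (pairs l)
  <= sum_list (fun a => sum_list (W a) l - W a a) l.
Proof.
  intros HW. induction l as [|a l IH]; cbn [pairs]; [apply Rle_refl|].
  rewrite sum_list_app, sum_list_map.
  cbn [fst snd]. rewrite !sum_list_cons.
  assert (H : sum_list (fun b => sum_list (W b) l - W b b) l
     <= sum_list (fun b => sum_list (W b) (a :: l) - W b b) l).
  { apply sum_list_le. intros b _. rewrite sum_list_cons. pose proof (HW b a); lra. }
  change (fun x => W a x) with (W a). lra.
Qed.

(** An element is dropped when it is close to one after it in [l], and it pays for this with a close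
    pair of which it is the first member; so no close pair is charged twice. *)
Lemma independent_sublist {A : Type} (close : A -> A -> Prop) (l : list A) :
  exists S, incl S l /\ ForallOrdPairs (fun a b => ~ close a b) S /\
    (length l <= length S + count (fun p => close (fst p) (snd p)) (pairs l))%nat.
Proof.
  induction l as [|a l [S [Hi [Hf Hl]]]].
  - exists []. split; [easy|split; [constructor|easy]].
  - cbn [pairs]. rewrite count_app.
    destruct (classic (exists b, In b l /\ close a b)) as [[b [Hb Hc]]|Hno].
    + exists S. split; [intros x Hx; right; auto|split; [exact Hf|]].
      assert (1 <= count (fun p => close (fst p) (snd p)) (map (pair a) l))%nat.
      { apply in_split in Hb as [l1 [l2 ->]]. rewrite map_app, count_app. cbn [map].
        rewrite count_cons_true by exact Hc. lia. }
      cbn [length]. lia.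
    + exists (a :: S). split; [|split].
      * intros x [->|Hx]; [left|right]; auto.
      * constructor; [|exact Hf]. apply Forall_forall. intros b Hb Hc.
        apply Hno. exists b; auto.
      * cbn [length]. lia.
Qed.

Lemma ForallOrdPairs_nth {A : Type} (Q : A -> A -> Prop) (l : list A) (x0 : A) :
  ForallOrdPairs Q l <->
  (forall i j, (i < j < length l)%nat -> Q (nth i l x0) (nth j l x0)).
Proof.
  split.
  - induction 1 as [|a l Ha Hl IH]; cbn; [lia|].
    intros [|i] [|j] Hij; try lia.
    + rewrite Forall_forall in Ha. apply Ha, nth_In; lia.
    + apply IH; lia.
  - induction l as [|a l IH]; intros H; constructor.
    + apply Forall_forall. intros b Hb. apply (In_nth _ _ x0) in Hb as [j [Hj <-]].
      apply (H 0%nat (S j)); cbn; lia.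
    + apply IH. intros i j Hij. apply (H (S i) (S j)); cbn; lia.
Qed.

Lemma is_packing_iff {T : Type} (dT : T -> T -> R) (X : T -> Prop) (delta : R) (l : list T) (x0 : T) :
  is_packing dT X delta l x0 <->
  (forall p, In p l -> X p) /\ ForallOrdPairs (fun p q => dT p q > delta) l.
Proof. unfold is_packing. now rewrite ForallOrdPairs_nth. Qed.

Lemma is_packing_number_unique {T : Type} (dT : T -> T -> R) (X : T -> Prop) (n m m' : nat) :
  is_packing_number dT X n m -> is_packing_number dT X n m' -> m = m'.
Proof.
  intros [[l [x [H1 H2]]] H3] [[l' [x' [H4 H5]]] H6].
  apply H3 in H4. apply H6 in H1. lia.
Qed.

Lemma is_packing_number_exists {T : Type} (dT : T -> T -> R) (X : T -> Prop) (n B : nat) (x0 : T) :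
  (forall l x, is_packing dT X (/ 2 ^ n) l x -> (length l <= B)%nat) ->
  exists m, is_packing_number dT X n m.
Proof.
  intros HB.
  assert (G : forall k, (exists m, is_packing_number dT X n m) \/
            exists l x, is_packing dT X (/ 2 ^ n) l x /\ (k <= length l)%nat).
  { induction k as [|k [IH|[l [x [Hl Hk]]]]].
    - right. exists [], x0. split; [split; cbn; [tauto|lia]|lia].
    - auto.
    - destruct (classic (exists l x, is_packing dT X (/ 2 ^ n) l x /\ (S k <= length l)%nat)) as [H|H].
      + auto.
      + left. exists (length l). split; [exists l, x; auto|].
        intros l' x' Hl'. apply Nat.nlt_ge. intros Hlt. apply H.
        exists l', x'. split; [auto|lia]. }
  destruct (G (S B)) as [H|[l [x [Hl Hk]]]]; [exact H|].
  apply HB in Hl. lia.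
Qed.

(** Pigeonhole: a cell of diameter at most [delta] holds at most one packing point, so [cell] is
    injective on the packing. *)
Lemma packing_length_le {T C : Type} (dT : T -> T -> R) (X : T -> Prop) (delta : R)
  (cell : T -> C) (cells : list C) (l : list T) (x0 : T) :
  (forall p, X p -> In (cell p) cells) ->
  (forall p q, X p -> X q -> cell p = cell q -> dT p q <= delta) ->
  is_packing dT X delta l x0 -> (length l <= length cells)%nat.
Proof.
  intros Hc Hd. rewrite is_packing_iff. intros [HX HP].
  rewrite <- (length_map cell). apply NoDup_incl_length.
  - induction HP as [|a l Ha Hl IH]; cbn; constructor.
    + rewrite in_map_iff. intros [b [E Hb]]. rewrite Forall_forall in Ha.
      specialize (Ha b Hb). cbn in HX. specialize (Hd a b (HX a (or_introl eq_refl)) (HX b (or_intror Hb)) (eq_sym E)). lra.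
    + apply IH. intros p Hp; apply HX; right; auto.
  - intros c. rewrite in_map_iff. intros [p [<- Hp]]. auto.
Qed.

(** * Multi-indices, sums of products and harmonic sums *)

Fixpoint idx (d m : nat) : list (list nat) :=
  match d with
  | O => [[]]
  | S d => flat_map (fun a => map (cons a) (idx d m)) (seq 0 m)
  end.

Lemma In_idx (d m : nat) (j : list nat) :
  In j (idx d m) <-> length j = d /\ forall k, (k < d)%nat -> (nth k j 0 < m)%nat.
Proof.
  revert j. induction d as [|d IH]; intros j; cbn.
  - split; [intros [<-|[]]; split; [reflexivity|lia]|].
    intros [H _]. left. symmetry. now apply length_zero_iff_nil.
  - rewrite in_flat_map. split.
    + intros [a [Ha H]]. apply in_map_iff in H as [j' [<- H]].
      apply in_seq in Ha. apply IH in H as [H1 H2]. split; [cbn; lia|].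
      intros [|k] Hk; cbn; [lia|apply H2; lia].
    + intros [H1 H2]. destruct j as [|a j]; cbn in H1; [lia|].
      exists a. split; [apply in_seq; specialize (H2 0%nat); cbn in H2; lia|].
      apply in_map, IH. split; [lia|]. intros k Hk. apply (H2 (S k)); lia.
Qed.

Lemma length_idx (d m : nat) : length (idx d m) = (m ^ d)%nat.
Proof.
  induction d as [|d IH]; [reflexivity|]. cbn [idx Nat.pow].
  rewrite (flat_map_constant_length (c := (m ^ d)%nat)).
  - now rewrite length_seq.
  - intros. now rewrite length_map.
Qed.

Lemma NoDup_idx (d m : nat) : NoDup (idx d m).
Proof.
  induction d as [|d IH]; cbn; [repeat constructor; easy|].
  generalize (seq_NoDup m 0). generalize (seq 0 m). intros l Hl.
  induction Hl as [|a l Ha Hl IHl]; cbn; [constructor|].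
  apply NoDup_app; [|exact IHl|].
  - apply FinFun.Injective_map_NoDup; [|exact IH]. intros x y E; now inversion E.
  - intros x Hx Hx'. apply in_map_iff in Hx as [j [<- _]].
    apply in_flat_map in Hx' as [b [Hb Hx']]. apply in_map_iff in Hx' as [j' [E _]].
    inversion E; subst; auto.
Qed.

Lemma prodR_shift (n : nat) (f : nat -> R) : prodR (S n) f = f 0%nat * prodR n (fun k => f (S k)).
Proof.
  induction n as [|n IH]; [cbn; lra|].
  change (prodR (S (S n)) f) with (prodR (S n) f * f (S n)). rewrite IH. cbn. lra.
Qed.

Lemma prodR_ge0 (n : nat) (f : nat -> R) : (forall k, (k < n)%nat -> 0 <= f k) -> 0 <= prodR n f.
Proof.
  induction n as [|n IH]; cbn; intros H; [lra|].
  apply Rmult_le_pos; [apply IH; intros; apply H; lia|apply H; lia].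
Qed.

Lemma prodR_le (n : nat) (f g : nat -> R) :
  (forall k, (k < n)%nat -> 0 <= f k <= g k) -> prodR n f <= prodR n g.
Proof.
  induction n as [|n IH]; cbn; intros H; [lra|].
  apply Rmult_le_compat; [apply prodR_ge0; intros; apply H; lia|apply H; lia| |apply H; lia].
  apply IH; intros; apply H; lia.
Qed.

(** Distributivity over the grid. It turns the sum of pair bounds in a [d]-dimensional cluster into
    a product of one-dimensional sums, each essentially harmonic. *)
Lemma sum_idx_prodR (d m : nat) (u : nat -> nat -> R) :
  sum_list (fun j => prodR d (fun k => u k (nth k j 0%nat))) (idx d m)
  = prodR d (fun k => sum_list (u k) (seq 0 m)).
Proof.
  revert u. induction d as [|d IH]; intros u; [cbn; lra|].
  rewrite (prodR_shift d). cbn [idx].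
  rewrite <- (IH (fun k => u (S k))).
  generalize (seq 0 m). intros l.
  induction l as [|a l IHl]; cbn [flat_map]; [cbn; lra|].
  rewrite sum_list_app, IHl, sum_list_map.
  rewrite (sum_list_ext _ (fun j => u 0%nat a * prodR d (fun k => u (S k) (nth k j 0%nat)))).
  2:{ intros j _. now rewrite prodR_shift. }
  rewrite sum_list_scal. rewrite sum_list_cons. ring.
Qed.

Fixpoint harm (n : nat) : R := match n with O => 0 | S n => harm n + / INR (S n) end.

Lemma harm_le (m n : nat) : (m <= n)%nat -> harm m <= harm n.
Proof.
  induction 1 as [|n H IH]; [lra|]. cbn [harm].
  assert (0 < / INR (S n)) by (apply Rinv_0_lt_compat, lt_0_INR; lia). lra.
Qed.

(** Dyadic blocks: [G] with [p = k = 2^n] bounds the terms from [2^n + 1] to [2^(n+1)] by 1. *)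
Lemma harm_pow2 (n : nat) : harm (2 ^ n) <= INR n + 1.
Proof.
  assert (G : forall p k, (0 < p)%nat -> harm (p + k) <= harm p + INR k / INR p).
  { intros p k Hp. assert (0 < INR p) by now apply lt_0_INR.
    induction k as [|k IH]; [rewrite Nat.add_0_r; cbn; lra|].
    rewrite Nat.add_succ_r. cbn [harm].
    assert (/ INR (S (p + k)) <= / INR p) by (apply Rinv_le_contravar; [auto|apply le_INR; lia]).
    rewrite (S_INR k). unfold Rdiv in *. lra. }
  induction n as [|n IH]; [cbn; rewrite Rinv_1; lra|].
  replace (2 ^ S n)%nat with (2 ^ n + 2 ^ n)%nat by (cbn; lia).
  assert (H2 : (0 < 2 ^ n)%nat) by (apply Nat.neq_0_lt_0, Nat.pow_nonzero; lia).
  specialize (G (2 ^ n)%nat (2 ^ n)%nat H2).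
  unfold Rdiv in G. rewrite Rinv_r in G by (apply not_0_INR; lia).
  rewrite S_INR. lra.
Qed.

(** On either side of [a] the distances [|a - b|] run through consecutive integers from 1, so each
    side is a harmonic sum ([L] on the left, [U] on the right); the 1 is the term [b = a]. *)
Lemma sum_inv_dist_le (c : R) (m a : nat) : 0 <= c -> (a < m)%nat ->
  sum_list (fun b => if Nat.eq_dec a b then 1 else c / Rabs (INR a - INR b)) (seq 0 m)
  <= 1 + 2 * c * harm m.
Proof.
  intros Hc Ha.
  assert (L : forall n s, sum_list (fun b => / (INR (s + n) - INR b)) (seq s n) = harm n).
  { induction n as [|n IH]; intros s; [reflexivity|].
    cbn [seq]. rewrite sum_list_cons.
    replace (s + S n)%nat with (S s + n)%nat by lia. rewrite IH. cbn [harm].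
    replace (INR (S s + n) - INR s) with (INR (S n)); [ring|].
    rewrite plus_INR, !S_INR; ring. }
  assert (U : forall n, sum_list (fun b => / (INR b - INR a)) (seq (S a) n) = harm n).
  { induction n as [|n IH]; [reflexivity|].
    rewrite seq_S, sum_list_app, IH, sum_list_cons. cbn [harm sum_list fold_right].
    replace (INR (S a + n) - INR a) with (INR (S n)); [ring|].
    rewrite plus_INR, !S_INR; ring. }
  replace m with (a + S (m - S a))%nat at 1 by lia.
  rewrite seq_app, sum_list_app. cbn [seq Nat.add].
  rewrite sum_list_cons.
  destruct (Nat.eq_dec a a) as [_|]; [|tauto].
  rewrite (sum_list_ext _ (fun b => c * / (INR (0 + a) - INR b)) (seq 0 a)).
  2:{ intros b Hb. apply in_seq in Hb. destruct (Nat.eq_dec a b); [lia|].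
      assert (INR b < INR a) by (apply lt_INR; lia).
      rewrite Rabs_right by lra. reflexivity. }
  rewrite (sum_list_ext _ (fun b => c * / (INR b - INR a)) (seq (S a) _)).
  2:{ intros b Hb. apply in_seq in Hb. destruct (Nat.eq_dec a b); [lia|].
      assert (INR a < INR b) by (apply lt_INR; lia).
      rewrite Rabs_left by lra. unfold Rdiv. now rewrite Ropp_minus_distr. }
  rewrite !sum_list_scal, L, U.
  assert (harm a <= harm m) by (apply harm_le; lia).
  assert (harm (m - S a) <= harm m) by (apply harm_le; lia). nra.
Qed.

(** The left side is convex in [x], and the right side is its chord over [[0, 1]]. *)
Lemma pow_1_plus_le (x : R) (d : nat) : 0 <= x <= 1 -> (1 + x) ^ d <= 1 + (2 ^ d - 1) * x.
Proof.
  intros Hx. induction d as [|d IH]; [cbn; lra|].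
  assert (1 <= 2 ^ d) by (apply pow_R1_Rle; lra).
  cbn [pow]. eapply Rle_trans; [apply Rmult_le_compat_l; [lra|exact IH]|].
  assert (0 <= (2 ^ d - 1) * (x * (1 - x))) by (repeat apply Rmult_le_pos; lra). lra.
Qed.

Lemma prodR_const (n : nat) (c : R) : prodR n (fun _ => c) = c ^ n.
Proof. induction n as [|n IH]; cbn; [lra|rewrite IH; lra]. Qed.

(** The sum factors into [d] sums of at most [1 + x]. The leading 1 is kept apart because it stands
    for [j' = j] and is subtracted later; only the remainder becomes small with [x]. *)
Lemma sum_idx_inv_dist_le (c x : R) (d m : nat) (j : list nat) :
  0 <= c -> 2 * c * harm m <= x -> 0 <= x <= 1 -> In j (idx d m) ->
  sum_list (fun j' => prodR d (fun k =>
      if Nat.eq_dec (nth k j 0%nat) (nth k j' 0%nat) then 1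
      else c / Rabs (INR (nth k j 0%nat) - INR (nth k j' 0%nat)))) (idx d m)
  <= 1 + (2 ^ d - 1) * x.
Proof.
  intros Hc Hh Hx Hj. apply In_idx in Hj as [_ Hj].
  rewrite (sum_idx_prodR d m (fun k b => if Nat.eq_dec (nth k j 0%nat) b then 1
      else c / Rabs (INR (nth k j 0%nat) - INR b))).
  eapply Rle_trans; [|now apply pow_1_plus_le]. rewrite <- prodR_const.
  apply prodR_le. intros k Hk. split.
  - apply sum_list_ge0. intros b _. destruct (Nat.eq_dec _ b) as [|Hb]; [lra|].
    apply Rmult_le_pos; [lra|]. left. apply Rinv_0_lt_compat, Rabs_pos_lt.
    intros E. apply Hb, INR_eq. lra.
  - eapply Rle_trans; [apply sum_inv_dist_le; auto|]. lra.
Qed.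

(** * Euclidean norm, product metric and continuity *)

Lemma sumsq_ge0 (d : nat) (z : nat -> R) : 0 <= sumsq d z.
Proof. induction d as [|d IH]; cbn [sumsq]; [lra|]. pose proof (pow2_ge_0 (z d)); lra. Qed.

Lemma eucl_ge0 (d : nat) (z : nat -> R) : 0 <= eucl d z.
Proof. apply sqrt_pos. Qed.

Lemma Rabs_le_eucl (d k : nat) (z : nat -> R) : (k < d)%nat -> Rabs (z k) <= eucl d z.
Proof.
  intros Hk. unfold eucl. rewrite <- sqrt_Rsqr_abs. apply sqrt_le_1_alt.
  induction d as [|d IH]; [lia|]. cbn [sumsq]. unfold Rsqr in *.
  pose proof (sumsq_ge0 d z).
  destruct (Nat.eq_dec k d) as [->|Hne]; [nra|].
  pose proof (pow2_ge_0 (z d)). specialize (IH ltac:(lia)). lra.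
Qed.

Lemma eucl_le (d : nat) (z : nat -> R) (r : R) : 0 <= r ->
  (forall k, (k < d)%nat -> Rabs (z k) <= r) -> eucl d z <= INR d * r.
Proof.
  intros Hr Hz. unfold eucl.
  rewrite <- (sqrt_Rsqr (INR d * r)) by (apply Rmult_le_pos; [apply pos_INR|exact Hr]).
  apply sqrt_le_1_alt.
  induction d as [|d IH]; [cbn; unfold Rsqr; lra|]. cbn [sumsq].
  specialize (IH (fun k Hk => Hz k (Nat.lt_lt_succ_r _ _ Hk))).
  specialize (Hz d (Nat.lt_succ_diag_r d)).
  assert (z d ^ 2 <= r ^ 2).
  { rewrite <- (pow2_abs (z d)). apply pow_incr. split; [apply Rabs_pos|exact Hz]. }
  rewrite S_INR. unfold Rsqr in *. pose proof (pos_INR d). 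
  assert (0 <= INR d * (r * r)) by (apply Rmult_le_pos; nra). nra.
Qed.

Lemma prod_dist_le (K : MetricSpace) (d : nat) (p q : K * (nat -> R)) (a b : R) :
  0 <= mdist K (fst p) (fst q) <= a -> eucl d (vsub (snd p) (snd q)) <= b -> prod_dist K d p q <= a + b.
Proof.
  intros Ha Hb. unfold prod_dist. pose proof (eucl_ge0 d (vsub (snd p) (snd q))).
  rewrite <- (sqrt_pow2 (a + b)) by lra. apply sqrt_le_1_alt. nra.
Qed.

Lemma mdist_le_prod_dist (K : MetricSpace) (d : nat) (p q : K * (nat -> R)) :
  mdist K (fst p) (fst q) <= prod_dist K d p q.
Proof.
  unfold prod_dist. eapply Rle_trans; [apply Rle_abs|].
  rewrite <- sqrt_Rsqr_abs. apply sqrt_le_1_alt. unfold Rsqr.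
  pose proof (pow2_ge_0 (eucl d (vsub (snd p) (snd q)))). lra.
Qed.

Lemma eucl_le_prod_dist (K : MetricSpace) (d : nat) (p q : K * (nat -> R)) :
  eucl d (vsub (snd p) (snd q)) <= prod_dist K d p q.
Proof.
  unfold prod_dist. eapply Rle_trans; [apply Rle_abs|].
  rewrite <- sqrt_Rsqr_abs. apply sqrt_le_1_alt. unfold Rsqr.
  pose proof (pow2_ge_0 (mdist K (fst p) (fst q))). lra.
Qed.

Lemma mdist_refl (K : MetricSpace) (x : K) : mdist K x x = 0.
Proof. now apply Defs.dist_eq0. Qed.

Lemma mdist_ge0 (K : MetricSpace) (x y : K) : 0 <= mdist K x y.
Proof.
  pose proof (Defs.dist_tri K x y x). rewrite mdist_refl, (Defs.dist_sym K y x) in H. lra.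
Qed.

Lemma mdist_pos (K : MetricSpace) (x y : K) : x <> y -> 0 < mdist K x y.
Proof.
  intros H. destruct (Rle_lt_or_eq_dec _ _ (mdist_ge0 K x y)) as [|E]; [auto|].
  symmetry in E. now apply Defs.dist_eq0 in E.
Qed.

(** Minimum of finitely many radii; it serves wherever one radius must suit all members of a finite
    configuration. *)
Lemma uniform_radius {A : Type} (Q : A -> R -> Prop) (l : list A) :
  (forall a r s, Q a r -> s <= r -> Q a s) ->
  (forall a, In a l -> exists r, 0 < r /\ Q a r) ->
  exists r, 0 < r /\ forall a, In a l -> Q a r.
Proof.
  intros HQ. induction l as [|a l IH]; intros H.
  - exists 1. split; [lra|]. intros a [].
  - destruct IH as [r [Hr Hl]]; [intros; apply H; right; auto|].
    destruct (H a) as [s [Hs Ha]]; [left; auto|].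
    exists (Rmin r s). split; [now apply Rmin_pos|].
    intros b [<-|Hb]; [apply (HQ _ s); [auto|apply Rmin_r]|apply (HQ _ r); [auto|apply Rmin_l]].
Qed.

Definition cont (K : MetricSpace) (u : K -> R) : Prop :=
  forall x eps, eps > 0 -> exists delta, delta > 0 /\
    forall y, mdist K x y < delta -> Rabs (u x - u y) < eps.

Lemma inC_iff (K : MetricSpace) (d : nat) (f : K -> nat -> R) :
  inC K d f <-> (forall x i, (d <= i)%nat -> f x i = 0) /\ forall i, cont K (fun x => f x i).
Proof.
  split.
  - intros [H0 Hc]. split; [exact H0|]. intros i x eps He.
    destruct (Nat.lt_ge_cases i d) as [Hi|Hi].
    + destruct (Hc x eps He) as [r [Hr H]]. exists r; split; [exact Hr|].
      intros y Hy. eapply Rle_lt_trans; [|apply (H y Hy)].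
      apply (Rabs_le_eucl d i (vsub (f x) (f y)) Hi).
    + exists 1; split; [lra|]. intros y _. rewrite !H0 by exact Hi.
      rewrite Rminus_diag, Rabs_R0. exact He.
  - intros [H0 Hc]. split; [exact H0|]. intros x eps He.
    pose proof (pos_INR d).
    (* [eucl_le] loses a factor [d]; the [+ 1] gives strictness and covers [d = 0]. *)
    set (e := eps / (INR d + 1)).
    assert (He' : 0 < e) by (apply Rdiv_lt_0_compat; lra).
    destruct (uniform_radius (fun i r => forall y, mdist K x y < r -> Rabs (f x i - f y i) < e)
                (seq 0 d)) as [r [Hr HQ]].
    + intros i r s HQ Hs y Hy. apply HQ; lra.
    + intros i _. destruct (Hc i x e He') as [r [Hr HQ]]. exists r; auto.
    + exists r; split; [exact Hr|]. intros y Hy.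
      eapply Rle_lt_trans; [apply (eucl_le d _ e)|].
      * lra.
      * intros k Hk. left. apply HQ; [apply in_seq; lia|exact Hy].
      * unfold e. apply (Rmult_lt_reg_r (INR d + 1)); [lra|].
        replace (INR d * (eps / (INR d + 1)) * (INR d + 1)) with (INR d * eps) by (field; lra). nra.
Qed.

Lemma cont_bounded (K : MetricSpace) (u : K -> R) :
  compact_space K -> cont K u -> exists M, forall x, Rabs (u x) <= M.
Proof.
  intros HK Hu. apply NNPP; intros Hno.
  assert (H : forall n : nat, exists x, INR n < Rabs (u x)).
  { intros n. apply NNPP; intros Hn. apply Hno. exists (INR n). intros x.
    apply Rnot_lt_le; intros Hx. apply Hn; now exists x. }
  set (s := fun n => proj1_sig (constructive_indefinite_description _ (H n))).
  assert (Hs : forall n, INR n < Rabs (u (s n)))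
    by (intros n; exact (proj2_sig (constructive_indefinite_description _ (H n)))).
  destruct (HK s) as [phi [x [Hphi Hx]]].
  destruct (Hu x 1) as [r [Hr Hc]]; [lra|].
  destruct (Hx r Hr) as [N HN].
  destruct (INR_unbounded (Rabs (u x) + 1)) as [M HM].
  assert (Hge : forall n, (n <= phi n)%nat).
  { induction n as [|n IH]; [lia|]. specialize (Hphi n). lia. }
  set (n := Nat.max N M).
  specialize (HN n ltac:(lia)). rewrite Defs.dist_sym in HN. apply Hc in HN.
  specialize (Hs (phi n)).
  assert (INR M <= INR (phi n)) by (apply le_INR; specialize (Hge n); lia).
  pose proof (Rabs_triang_inv (u (s (phi n))) (u x)). rewrite Rabs_minus_sym in HN. lra.
Qed.

Lemma inC_bounded (K : MetricSpace) (d : nat) (f : K -> nat -> R) :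
  compact_space K -> inC K d f -> exists M : nat, (1 <= M)%nat /\
    forall x k, (k < d)%nat -> Rabs (f x k) < INR M.
Proof.
  intros HK Hf. apply inC_iff in Hf as [_ Hc].
  induction d as [|d [M [HM IH]]]; [exists 1%nat; split; [lia|intros; lia]|].
  destruct (cont_bounded K _ HK (Hc d)) as [B HB].
  destruct (INR_unbounded B) as [M' HM'].
  exists (M + M')%nat. split; [lia|]. intros x k Hk. rewrite plus_INR.
  pose proof (pos_INR M); pose proof (pos_INR M').
  destruct (Nat.eq_dec k d) as [->|Hne].
  - specialize (HB x). assert (0 < INR M) by (apply lt_0_INR; lia). lra.
  - specialize (IH x k ltac:(lia)). lra.
Qed.

(** * Box dimensions from packing estimates *)

(** The index shifts record the scales that are compared: [K] at [2^-n] with the graph at [2^-(n+1)]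
    from below, [K] at [2^-(n+2)] with the graph at [2^-n] from above. Changing the [n] in the
    denominator of [box_ratio] rescales [a] by a factor near 1; as [a] may be unbounded, this error
    has to be multiplicative. *)
Definition asymptotically_shifted (a b : nat -> R) (D : R) : Prop :=
  (exists N, forall n, (N <= n)%nat -> 0 <= a n) /\
  (forall e, 0 < e -> exists N, forall n, (N <= n)%nat -> (1 - e) * a n + D - e <= b (S n)) /\
  (forall e, 0 < e -> exists N, forall n, (N <= n)%nat -> b n <= (1 + e) * a (n + 2)%nat + D + e).

(* The tolerance [e] turns the multiplicative loss at a value near [l] into an additive one. *)
Lemma small_relative_error (l eps : R) : eps > 0 ->
  exists e, 0 < e < 1 /\ e <= eps / 4 /\ e * (Rabs l + eps) <= eps / 4.
Proof.
  intros He. pose proof (Rabs_pos l).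
  exists (Rmin (1 / 2) (Rmin (eps / 4) (eps / 4 / (Rabs l + eps)))).
  assert (Hp : 0 < eps / 4 / (Rabs l + eps)) by (apply Rdiv_lt_0_compat; lra).
  assert (0 < Rmin (1 / 2) (Rmin (eps / 4) (eps / 4 / (Rabs l + eps))))
    by (repeat apply Rmin_pos; lra).
  pose proof (Rmin_l (1 / 2) (Rmin (eps / 4) (eps / 4 / (Rabs l + eps)))).
  pose proof (Rmin_r (1 / 2) (Rmin (eps / 4) (eps / 4 / (Rabs l + eps)))).
  pose proof (Rmin_l (eps / 4) (eps / 4 / (Rabs l + eps))).
  pose proof (Rmin_r (eps / 4) (eps / 4 / (Rabs l + eps))).
  split; [lra|split; [lra|]].
  apply Rle_trans with (eps / 4 / (Rabs l + eps) * (Rabs l + eps)); [|right; field; lra].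
  apply Rmult_le_compat_r; lra.
Qed.

Lemma shifted_lower_estimate (a b : nat -> R) (D l eps : R) :
  asymptotically_shifted a b D -> eps > 0 ->
  exists N, forall n, (N <= n)%nat -> a n > l - eps / 4 -> b (S n) > l + D - eps.
Proof.
  intros [_ [HL _]] He.
  destruct (small_relative_error l eps He) as [e [He1 [He2 He3]]].
  destruct (HL e ltac:(lra)) as [N HN]. exists N. intros n Hn Ha. specialize (HN n Hn).
  pose proof (Rle_abs l). pose proof (Rmult_lt_compat_l (1 - e) _ _ ltac:(lra) Ha). nra.
Qed.

Lemma shifted_upper_estimate (a b : nat -> R) (D l eps : R) :
  asymptotically_shifted a b D -> eps > 0 ->
  exists N, forall n, (N <= n)%nat -> a (n + 2)%nat < l + eps / 4 -> b n < l + D + eps.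
Proof.
  intros [_ [_ HU]] He.
  destruct (small_relative_error l eps He) as [e [He1 [He2 He3]]].
  destruct (HU e ltac:(lra)) as [N HN]. exists N. intros n Hn Ha. specialize (HN n Hn).
  pose proof (Rle_abs l). pose proof (Rmult_lt_compat_l (1 + e) _ _ ltac:(lra) Ha). nra.
Qed.

Lemma shifted_lower_infinite (a b : nat -> R) (D M : R) :
  asymptotically_shifted a b D ->
  exists N M', forall n, (N <= n)%nat -> a n > M' -> b (S n) > M.
Proof.
  intros [_ [HL _]]. destruct (HL (1 / 2) ltac:(lra)) as [N HN].
  exists N, (2 * (M - D + 1)). intros n Hn Ha. specialize (HN n Hn). lra.
Qed.

Lemma is_liminf_shifted (a b : nat -> R) (d : nat) (v : Rbar) :
  asymptotically_shifted a b (INR d) -> is_liminf a v -> is_liminf b (Rbar_plus_nat v d).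
Proof.
  intros Hs. destruct v as [l|]; cbn; intros Ha.
  - intros eps He. destruct (Ha (eps / 4) ltac:(lra)) as [[N HN] Hio]. split.
    + destruct (shifted_lower_estimate a b _ l eps Hs He) as [N' HN'].
      exists (S (N + N')). intros [|n] Hn; [lia|]. apply HN'; [lia|apply HN; lia].
    + destruct (shifted_upper_estimate a b _ l eps Hs He) as [N' HN'].
      intros M. destruct (Hio (M + N' + 2)%nat) as [n [Hn Hn']].
      exists (n - 2)%nat. split; [lia|]. apply HN'; [lia|].
      now replace (n - 2 + 2)%nat with n by lia.
  - intros M. destruct (shifted_lower_infinite a b _ M Hs) as [N [M' H]].
    destruct (Ha M') as [N' HN'].
    exists (S (N + N')). intros [|n] Hn; [lia|]. apply H; [lia|apply HN'; lia].
Qed.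

Lemma is_limsup_shifted (a b : nat -> R) (d : nat) (v : Rbar) :
  asymptotically_shifted a b (INR d) -> is_limsup a v -> is_limsup b (Rbar_plus_nat v d).
Proof.
  intros Hs. destruct v as [l|]; cbn; intros Ha.
  - intros eps He. destruct (Ha (eps / 4) ltac:(lra)) as [[N HN] Hio]. split.
    + destruct (shifted_upper_estimate a b _ l eps Hs He) as [N' HN'].
      exists (N + N')%nat. intros n Hn. apply HN'; [lia|apply HN; lia].
    + destruct (shifted_lower_estimate a b _ l eps Hs He) as [N' HN'].
      intros M. destruct (Hio (M + N')%nat) as [n [Hn Hn']].
      exists (S n). split; [lia|]. apply HN'; [lia|exact Hn'].
  - intros M N. destruct (shifted_lower_infinite a b _ M Hs) as [N0 [M' H]].
    destruct (Ha M' (N + N0)%nat) as [n [Hn Hn']].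
    exists (S n). split; [lia|]. apply H; [lia|exact Hn'].
Qed.

Lemma eventually_small (C e : R) : 0 < e ->
  exists N, forall n, (N <= n)%nat -> C / sqrt (INR n + 2) <= e.
Proof.
  intros He. destruct (INR_unbounded ((C / e) ^ 2)) as [N HN]. exists N. intros n Hn.
  apply le_INR in Hn. pose proof (pos_INR n).
  assert (Hs : 0 < sqrt (INR n + 2)) by (apply sqrt_lt_R0; lra).
  assert (C / e <= sqrt (INR n + 2)).
  { eapply Rle_trans; [apply Rle_abs|]. rewrite <- sqrt_Rsqr_abs. apply sqrt_le_1_alt.
    unfold Rsqr. cbn in HN. lra. }
  apply (Rmult_le_reg_r (sqrt (INR n + 2))); [exact Hs|].
  unfold Rdiv. rewrite Rmult_assoc, Rinv_l, Rmult_1_r by lra.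
  apply (Rmult_le_compat_l e) in H0; [|lra].
  replace (e * (C / e)) with C in H0 by (field; lra). exact H0.
Qed.

(** Applied to [n + 2], it makes the polynomial factor in the cluster size an error of order
    [sqrt n], which division by [n] kills. *)
Lemma ln_le_2_sqrt (x : R) : 0 < x -> ln x <= 2 * sqrt x.
Proof.
  intros Hx. pose proof (sqrt_lt_R0 x Hx) as Hs.
  rewrite <- (sqrt_sqrt x) at 1 by lra. rewrite ln_mult by assumption.
  assert (ln (sqrt x) <= sqrt x); [|lra].
  pose proof (exp_ineq1_le (ln (sqrt x))). rewrite exp_ln in H by exact Hs. lra.
Qed.

Lemma ln_2_pos : 0 < ln 2.
Proof. rewrite <- ln_1. apply ln_increasing; lra. Qed.

Lemma ln_le_mono (x y : R) : 0 < x -> x <= y -> ln x <= ln y.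
Proof.
  intros Hx [H| ->]; [left; now apply ln_increasing|right; reflexivity].
Qed.

Lemma ln_INR_ge0 (n : nat) : (1 <= n)%nat -> 0 <= ln (INR n).
Proof.
  intros H. rewrite <- ln_1. apply ln_le_mono; [lra|]. now apply (le_INR 1).
Qed.

Lemma ln_pow2 (n : nat) : ln (2 ^ n) = INR n * ln 2.
Proof. now rewrite ln_pow by lra. Qed.

(** In logarithms the bound on [m] reads [ln (m n) >= n ln 2 - O(sqrt n)], so [m n ^ d] adds [d] to
    the ratio in the limit; [S q] and [P ^ d] are constant factors and vanish after division by
    [n ln 2]. *)
Lemma asymptotically_shifted_box_ratio (N N' : nat -> nat) (d q P : nat) (m : nat -> nat) :
  (forall n, (1 <= N n)%nat) -> (forall n, (1 <= N' n)%nat) -> (1 <= P)%nat ->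
  (forall n, 2 ^ n <= INR (S (m n)) * (4 * (INR n + 2) ^ 5)) ->
  (exists n0, forall n, (n0 <= n)%nat -> (1 <= m n)%nat /\
     (N n * m n ^ d <= N' (S n) * S q)%nat) ->
  (forall n, (N' n <= N (n + 2) * (P * 2 ^ n) ^ d)%nat) ->
  asymptotically_shifted (box_ratio N) (box_ratio N') (INR d).
Proof.
  intros HN HN' HP Hm [n0 HL] HU. pose proof ln_2_pos as L2.
  pose proof (pos_INR d) as Hd.
  split; [|split].
  - exists 1%nat. intros n Hn. unfold box_ratio.
    apply Rmult_le_pos; [apply ln_INR_ge0, HN|]. left. apply Rinv_0_lt_compat, Rmult_lt_0_compat; [|exact L2].
    apply lt_0_INR; lia.
  - intros e He.
    (* [C] collects errors independent of [n]; [C'] is chosen so that [C' <= e s] yields [Herr]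
       after multiplication by [s ln 2 / 2], using [s^2 <= 2 (n + 1)]. *)
    set (C := ln (INR (S q)) + INR d * ln 8).
    set (C' := 2 * (1 + INR d + (Rabs C + 10 * INR d) / ln 2)).
    destruct (eventually_small C' e He) as [n1 Hn1].
    exists (n0 + n1 + 1)%nat. intros n Hn.
    destruct (HL n ltac:(lia)) as [Hm1 Hle]. specialize (Hn1 n ltac:(lia)).
    specialize (Hm n). specialize (HN n). specialize (HN' (S n)).
    assert (Hn' : 1 <= INR n) by (apply (le_INR 1); lia).
    set (s := sqrt (INR n + 2)) in *.
    assert (Hs : 1 <= s) by (unfold s; rewrite <- sqrt_1; apply sqrt_le_1_alt; lra).
    assert (Hss : s * s = INR n + 2) by (apply sqrt_sqrt; lra).
    (* [8 = 4 * 2] since [m + 1 <= 2 m]; [10 = 5 * 2] from the fifth power and [ln_le_2_sqrt]. *)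
    assert (Hlnm : INR n * ln 2 - 10 * s - ln 8 <= ln (INR (m n))).
    { assert (Hmp : 1 <= INR (m n)) by (now apply (le_INR 1)).
      assert (H2 : 2 ^ n <= INR (m n) * (8 * (INR n + 2) ^ 5)).
      { eapply Rle_trans; [exact Hm|]. rewrite S_INR.
        assert (0 < (INR n + 2) ^ 5) by (apply pow_lt; lra). nra. }
      apply ln_le_mono in H2; [|apply pow_lt; lra].
      rewrite ln_pow2, !ln_mult, ln_pow in H2; try (apply pow_lt); try (apply Rmult_lt_0_compat; [|apply pow_lt]); try lra.
      pose proof (ln_le_2_sqrt (INR n + 2) ltac:(lra)) as H3. fold s in H3.
      replace (INR 5) with 5 in H2 by (cbn; ring). lra. }
    assert (HB : ln (INR (N n)) + INR d * ln (INR (m n)) <= ln (INR (N' (S n))) + ln (INR (S q))).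
    { apply le_INR, ln_le_mono in Hle.
      - rewrite !mult_INR, pow_INR in Hle.
        assert (0 < INR (N n)) by (apply lt_0_INR; lia).
        assert (0 < INR (m n)) by (apply lt_0_INR; lia).
        assert (0 < INR (N' (S n))) by (apply lt_0_INR; lia).
        assert (0 < INR (S q)) by (apply lt_0_INR; lia).
        rewrite !ln_mult, ln_pow in Hle; auto using pow_lt.
      - apply lt_0_INR. apply Nat.mul_pos_pos; [lia|]. apply Nat.neq_0_lt_0, Nat.pow_nonzero; lia. }
    unfold box_ratio. rewrite S_INR.
    set (A := ln (INR (N n))) in *. set (B := ln (INR (N' (S n)))) in *.
    assert (HA : 0 <= A) by (apply ln_INR_ge0; exact HN).
    assert (Hmul : INR d * (INR n * ln 2 - 10 * s - ln 8) <= INR d * ln (INR (m n)))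
      by (apply Rmult_le_compat_l; auto).
    assert (HBl : A + INR d * (INR n * ln 2) - 10 * INR d * s - C <= B) by (unfold C; lra).
    assert (HC' : C' <= e * s).
    { apply (Rmult_le_compat_r s) in Hn1; [|lra]. unfold Rdiv in Hn1.
      rewrite Rmult_assoc, Rinv_l, Rmult_1_r in Hn1 by lra. exact Hn1. }
    assert (HCs : (1 + INR d) * ln 2 + Rabs C + 10 * INR d <= e * s * ln 2 / 2).
    { apply (Rmult_le_compat_r (ln 2 / 2)) in HC'; [|lra].
      replace (C' * (ln 2 / 2)) with ((1 + INR d) * ln 2 + Rabs C + 10 * INR d) in HC'; [lra|].
      unfold C'. field. lra. }
    assert (Hss2 : s * s <= 2 * (INR n + 1)) by lra.
    (* The term [d ln 2] appears because the graph is measured at scale [n + 1], while [m n ^ d]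
       supplies only [d n ln 2]. *)
    assert (Herr : INR d * ln 2 + 10 * INR d * s + Rabs C <= e * ((INR n + 1) * ln 2)).
    { pose proof (Rabs_pos C).
      apply Rle_trans with (s * ((1 + INR d) * ln 2 + Rabs C + 10 * INR d)).
      - assert (0 <= (s - 1) * (INR d * ln 2 + Rabs C)) by (apply Rmult_le_pos; nra).
        assert (0 <= s * ln 2) by nra. lra.
      - apply (Rmult_le_compat_l s) in HCs; [|lra].
        assert (0 < e * ln 2) by nra. nra. }
    (* Replacing [n] by [n + 1] in the denominator costs a factor [n / (n + 1) >= 1 - e]. *)
    assert (He1 : A / (INR n * ln 2) * (1 - e) <= A / ((INR n + 1) * ln 2)).
    { assert (Hen : 1 <= e * (INR n + 1)).
      { apply (Rmult_le_reg_r (ln 2)); [exact L2|].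
        pose proof (Rabs_pos C).
        apply Rle_trans with (INR d * ln 2 + 10 * INR d * s + Rabs C + ln 2).
        - pose proof (Rmult_le_pos _ _ Hd (Rlt_le _ _ L2)).
          assert (0 <= INR d * s) by nra. lra.
        - apply Rle_trans with (s * ((1 + INR d) * ln 2 + Rabs C + 10 * INR d)).
          + assert (0 <= (s - 1) * (INR d * ln 2 + Rabs C)) by (apply Rmult_le_pos; nra).
            assert (0 <= (s - 1) * ln 2) by nra. lra.
          + apply (Rmult_le_compat_l s) in HCs; [|lra].
            assert (0 < e * ln 2) by nra. nra. }
      replace (A / (INR n * ln 2) * (1 - e)) with ((A / ln 2) * ((1 - e) / INR n)) by (field; lra).
      replace (A / ((INR n + 1) * ln 2)) with ((A / ln 2) * (1 / (INR n + 1))) by (field; lra).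
      apply Rmult_le_compat_l; [apply Rmult_le_pos; [exact HA|left; now apply Rinv_0_lt_compat]|].
      apply (Rmult_le_reg_r (INR n * (INR n + 1))); [nra|].
      replace ((1 - e) / INR n * (INR n * (INR n + 1))) with ((1 - e) * (INR n + 1)) by (field; lra).
      replace (1 / (INR n + 1) * (INR n * (INR n + 1))) with (INR n) by (field; lra). lra. }
    assert (Hfin : A / ((INR n + 1) * ln 2) + INR d - e <= B / ((INR n + 1) * ln 2)).
    { assert (Hp : 0 < (INR n + 1) * ln 2) by nra.
      apply (Rmult_le_reg_r ((INR n + 1) * ln 2)); [exact Hp|].
      replace ((A / ((INR n + 1) * ln 2) + INR d - e) * ((INR n + 1) * ln 2))
        with (A + INR d * (INR n * ln 2) + INR d * ln 2 - e * ((INR n + 1) * ln 2)) by (field; lra).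
      replace (B / ((INR n + 1) * ln 2) * ((INR n + 1) * ln 2)) with B by (field; lra).
      pose proof (Rle_abs C). lra. }
    lra.
  - intros e He.
    set (C := INR d * ln (INR P)).
    assert (HC : 0 <= C) by (apply Rmult_le_pos; [exact Hd|now apply ln_INR_ge0]).
    (* The [2] pays for the denominator [n + 2] against [n], and [C / ln 2] for the constant factor
       [P ^ d]. *)
    destruct (INR_unbounded ((2 + C / ln 2) / e)) as [n1 Hn1].
    exists (S n1). intros n Hn. specialize (HU n).
    assert (HA1 := HN (n + 2)%nat).
    assert (Hn2 : INR n1 + 1 <= INR n) by (rewrite <- S_INR; apply le_INR; lia).
    pose proof (pos_INR n1).
    assert (He1 : 2 + C / ln 2 <= e * INR n).
    { apply (Rmult_lt_compat_l e) in Hn1; [|exact He].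
      replace (e * ((2 + C / ln 2) / e)) with (2 + C / ln 2) in Hn1 by (field; lra). nra. }
    assert (HC2 : 0 <= C / ln 2) by (apply Rmult_le_pos; [exact HC|left; now apply Rinv_0_lt_compat]).
    assert (HB : ln (INR (N' n)) <= ln (INR (N (n + 2)%nat)) + C + INR d * (INR n * ln 2)).
    { apply le_INR, ln_le_mono in HU; [|apply lt_0_INR; specialize (HN' n); lia].
      rewrite mult_INR, pow_INR, mult_INR, (pow_INR 2) in HU.
      assert (0 < INR (N (n + 2)%nat)) by (apply lt_0_INR; lia).
      assert (0 < INR P) by (apply lt_0_INR; lia).
      replace (INR 2) with 2 in HU by reflexivity.
      assert (0 < 2 ^ n) by (apply pow_lt; lra).
      rewrite ln_mult, ln_pow, ln_mult, ln_pow2 in HU; auto using pow_lt, Rmult_lt_0_compat.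
      unfold C. lra. }
    unfold box_ratio. rewrite plus_INR. replace (INR 2) with 2 by reflexivity.
    set (A := ln (INR (N (n + 2)%nat))) in *. set (B := ln (INR (N' n))) in *.
    assert (HA : 0 <= A) by (apply ln_INR_ge0; exact HA1).
    assert (Hp : 0 < INR n * ln 2) by nra.
    assert (H1 : B / (INR n * ln 2) <= A / (INR n * ln 2) + C / (INR n * ln 2) + INR d).
    { apply (Rmult_le_reg_r (INR n * ln 2)); [exact Hp|].
      replace ((A / (INR n * ln 2) + C / (INR n * ln 2) + INR d) * (INR n * ln 2))
        with (A + C + INR d * (INR n * ln 2)) by (field; lra).
      replace (B / (INR n * ln 2) * (INR n * ln 2)) with B by (field; lra). exact HB. }
    assert (H2 : C / (INR n * ln 2) <= e).
    { apply (Rmult_le_reg_r (INR n)); [lra|].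
      replace (C / (INR n * ln 2) * INR n) with (C / ln 2) by (field; lra). lra. }
    assert (H3 : A / (INR n * ln 2) <= (1 + e) * (A / ((INR n + 2) * ln 2))).
    { replace (A / (INR n * ln 2)) with ((A / ln 2) * (1 / INR n)) by (field; lra).
      replace ((1 + e) * (A / ((INR n + 2) * ln 2))) with ((A / ln 2) * ((1 + e) / (INR n + 2))) by (field; lra).
      apply Rmult_le_compat_l; [apply Rmult_le_pos; [exact HA|left; now apply Rinv_0_lt_compat]|].
      apply (Rmult_le_reg_r (INR n * (INR n + 2))); [nra|].
      replace (1 / INR n * (INR n * (INR n + 2))) with (INR n + 2) by (field; lra).
      replace ((1 + e) / (INR n + 2) * (INR n * (INR n + 2))) with ((1 + e) * INR n) by (field; lra). lra. }
    lra.
Qed.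

(** Each cell sits in the product of a ball of radius [2^-(n+2)] around a point of a maximal packing
    of [K] and a cube of side [h]. Two points of a cell differ by at most [2 * 2^-(n+2)] in [K] and
    by at most [d h = 2^-(n+1)] in value, in total [2^-n]; this fixes both the scale [n + 2] and
    [h]. *)
Lemma graph_packing_le (K : MetricSpace) (d : nat) (f : K -> nat -> R) (M n Nk : nat)
  (l : list (K * (nat -> R))) (x0 : K * (nat -> R)) :
  (1 <= M)%nat -> (1 <= d)%nat ->
  (forall x k, (k < d)%nat -> Rabs (f x k) < INR M) ->
  is_packing_number (mdist K) (fun _ => True) (n + 2) Nk ->
  is_packing (prod_dist K d) (graph f) (/ 2 ^ n) l x0 ->
  (length l <= Nk * (4 * M * d * 2 ^ n) ^ d)%nat.
Proof.
  intros HM Hd Hf [[L [z0 [HL HLn]]] Hmax].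
  assert (HD : 1 <= INR d) by now apply (le_INR 1).
  assert (HM' : 1 <= INR M) by now apply (le_INR 1).
  assert (H2n : 1 <= 2 ^ n) by (apply pow_R1_Rle; lra).
  (* A maximal packing is a net: a point far from all of it could be added. *)
  assert (Hcenter : forall x : K, exists c, In c L /\ mdist K c x <= / 2 ^ (n + 2)).
  { intros x. apply NNPP; intros Hno.
    assert (HP : is_packing (mdist K) (fun _ => True) (/ 2 ^ (n + 2)) (x :: L) z0).
    { apply is_packing_iff. split; [auto|]. apply is_packing_iff in HL as [_ HL].
      constructor; [|exact HL]. apply Forall_forall. intros c Hc. apply Rnot_le_gt; intros Hle.
      apply Hno. exists c. split; [exact Hc|]. now rewrite Defs.dist_sym. }
    apply Hmax in HP. cbn in HP. lia. }
  set (center := fun x => proj1_sig (constructive_indefinite_description _ (Hcenter x))).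
  assert (Hcen : forall x, In (center x) L /\ mdist K (center x) x <= / 2 ^ (n + 2))
    by (intros x; exact (proj2_sig (constructive_indefinite_description _ (Hcenter x)))).
  set (Q := (4 * M * d * 2 ^ n)%nat).
  set (h := / (2 * INR d * 2 ^ n)).
  assert (Hh : 0 < h) by (apply Rinv_0_lt_compat; nra).
  (* Thus [Q] intervals of length [h] fill [[-M, M]], the range of each coordinate of [f]. *)
  assert (HQ : INR Q * h = 2 * INR M).
  { unfold Q, h. rewrite !mult_INR, pow_INR. replace (INR 4) with 4 by (cbn; ring).
    replace (INR 2) with 2 by reflexivity. field. lra. }
  set (coord := fun (p : K * (nat -> R)) k => Z.to_nat (Int_part ((snd p k + INR M) / h))).
  set (cell := fun p : K * (nat -> R) => (center (fst p), map (coord p) (seq 0 d))).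
  assert (Hnth : forall p k, (k < d)%nat -> nth k (map (coord p) (seq 0 d)) 0%nat = coord p k).
  { intros p k Hk. rewrite (nth_indep _ 0%nat (coord p 0%nat)) by (rewrite length_map, length_seq; exact Hk).
    rewrite map_nth, seq_nth by exact Hk. reflexivity. }
  assert (Hcoord : forall p k, graph f p -> (k < d)%nat ->
     0 <= (snd p k + INR M) / h /\ (coord p k < Q)%nat /\
     INR (coord p k) <= (snd p k + INR M) / h < INR (coord p k) + 1).
  { intros p k Hp Hk. specialize (Hf (fst p) k Hk). rewrite <- Hp in Hf. apply Rabs_def2 in Hf.
    set (t := (snd p k + INR M) / h).
    assert (Ht : 0 <= t) by (apply Rmult_le_pos; [lra|left; now apply Rinv_0_lt_compat]).
    assert (HtQ : t < INR Q).
    { apply (Rmult_lt_reg_r h); [exact Hh|]. unfold t.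
      replace ((snd p k + INR M) / h * h) with (snd p k + INR M) by (field; lra). lra. }
    destruct (base_Int_part t) as [B1 B2].
    assert (Hz : (0 <= Int_part t)%Z).
    { apply Z.nlt_ge; intros Hz. assert (Int_part t <= -1)%Z by lia. apply IZR_le in H. lra. }
    assert (E : INR (coord p k) = IZR (Int_part t)).
    { unfold coord. fold t. rewrite INR_IZR_INZ, Z2Nat.id by exact Hz. reflexivity. }
    rewrite E. split; [exact Ht|]. split; [|lra].
    apply INR_lt. lra. }
  intros Hl. replace (Nk * Q ^ d)%nat with (length (list_prod L (idx d Q)))
    by (rewrite length_prod, length_idx, HLn; reflexivity).
  refine (packing_length_le (prod_dist K d) (graph f) (/ 2 ^ n) cell _ l x0 _ _ Hl).
  - intros p Hp. apply in_prod; [apply Hcen|]. apply In_idx.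
    split; [now rewrite length_map, length_seq|]. intros k Hk.
    rewrite Hnth by exact Hk. now apply Hcoord.
  - intros p p' Hp Hp' E. injection E as E1 E2.
    replace (/ 2 ^ n) with (/ 2 ^ (n + 1) + / 2 ^ (n + 1)) by (rewrite pow_add; cbn; field; lra).
    apply prod_dist_le.
    + split; [apply mdist_ge0|]. destruct (Hcen (fst p)) as [_ D1]. destruct (Hcen (fst p')) as [_ D2].
      pose proof (Defs.dist_tri K (fst p) (center (fst p)) (fst p')) as T.
      rewrite (Defs.dist_sym K (fst p) (center (fst p))) in T. rewrite E1 in T at 2.
      replace (/ 2 ^ (n + 1)) with (/ 2 ^ (n + 2) + / 2 ^ (n + 2)) by (rewrite !pow_add; cbn; field; lra).
      lra.
    + replace (/ 2 ^ (n + 1)) with (INR d * h) by (unfold h; rewrite pow_add; cbn; field; lra).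
      apply eucl_le; [lra|]. intros k Hk.
      assert (Ek : coord p k = coord p' k) by (rewrite <- !Hnth by exact Hk; now rewrite E2).
      destruct (Hcoord p k Hp Hk) as [_ [_ B1]]. destruct (Hcoord p' k Hp' Hk) as [_ [_ B2]].
      rewrite Ek in B1. unfold vsub.
      replace (snd p k - snd p' k) with (((snd p k + INR M) / h - (snd p' k + INR M) / h) * h) by (field; lra).
      rewrite Rabs_mult, (Rabs_right h) by lra. apply Rle_trans with (1 * h); [|lra].
      apply Rmult_le_compat_r; [lra|]. left. apply Rabs_def1; lra.
Qed.

(** * The probe function *)

Lemma not_isolated_near (K : MetricSpace) (x : K) (r : R) (F : list K) :
  ~ isolated K x -> 0 < r -> exists y, mdist K x y < r /\ ~ In y F.
Proof.
  intros Hx Hr.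
  destruct (uniform_radius (fun z s => z <> x -> s <= mdist K x z) F) as [s [Hs HF]].
  - intros z a b H Hb Hz. specialize (H Hz). lra.
  - intros z _. destruct (classic (z = x)) as [->|Hz].
    + exists 1. split; [lra|tauto].
    + exists (mdist K x z). split; [apply mdist_pos; congruence|lra].
  - apply NNPP; intros Hno. apply Hx. exists (Rmin r s).
    split; [now apply Rmin_pos|]. intros y Hy. apply NNPP; intros Hne.
    apply Hno. exists y.
    pose proof (Rmin_l r s); pose proof (Rmin_r r s). split; [lra|].
    intros HyF. specialize (HF y HyF Hne). lra.
Qed.

(** The points are chosen one at a time, each avoiding [F] and the earlier choices; around a
    non-isolated point, finitely many exclusions never exhaust a ball. *)
Lemma distinct_points_near (K : MetricSpace) {A : Type} (V : list A) (ctr : A -> K) (r : R) (F : list K) :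
  NoDup V -> (forall v, In v V -> ~ isolated K (ctr v)) -> 0 < r -> inhabited K ->
  exists y : A -> K, (forall v, In v V -> mdist K (ctr v) (y v) < r /\ ~ In (y v) F) /\
    (forall v v', In v V -> In v' V -> y v = y v' -> v = v').
Proof.
  intros HV Hiso Hr [x0]. induction HV as [|v V Hv HV IH].
  - exists (fun _ => x0). split; [intros v []|intros v v' []].
  - destruct IH as [y [H1 H2]]; [intros; apply Hiso; right; auto|].
    destruct (not_isolated_near K (ctr v) r (F ++ map y V)) as [p [Hp Hp']];
      [apply Hiso; left; auto|exact Hr|].
    rewrite in_app_iff, in_map_iff in Hp'.
    exists (fun u => if excluded_middle_informative (u = v) then p else y u).
    split.
    + intros u Hu. destruct (excluded_middle_informative (u = v)) as [->|Hne]; [tauto|].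
      apply H1. destruct Hu; [congruence|auto].
    + intros u u' Hu Hu'.
      destruct (excluded_middle_informative (u = v)) as [->|Hne];
      destruct (excluded_middle_informative (u' = v)) as [->|Hne']; auto.
      * destruct Hu' as [->|Hu']; [tauto|]. intros E. exfalso. apply Hp'. right. exists u'. auto.
      * destruct Hu as [->|Hu]; [tauto|]. intros E. exfalso. apply Hp'. right. exists u. auto.
      * destruct Hu as [->|Hu]; [tauto|]. destruct Hu' as [->|Hu']; [tauto|]. now apply H2.
Qed.

Lemma cont_max (K : MetricSpace) (u v : K -> R) :
  cont K u -> cont K v -> cont K (fun x => Rmax (u x) (v x)).
Proof.
  intros Hu Hv x e He. destruct (Hu x e He) as [r [Hr HU]]. destruct (Hv x e He) as [s [Hs HV]].
  exists (Rmin r s). split; [now apply Rmin_pos|]. intros y Hy.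
  specialize (HU y (Rlt_le_trans _ _ _ Hy (Rmin_l _ _))).
  specialize (HV y (Rlt_le_trans _ _ _ Hy (Rmin_r _ _))).
  apply Rabs_def2 in HU, HV. unfold Rmax.
  destruct (Rle_dec (u x) (v x)); destruct (Rle_dec (u y) (v y)); apply Rabs_def1; lra.
Qed.

Lemma cont_plus (K : MetricSpace) (u v : K -> R) :
  cont K u -> cont K v -> cont K (fun x => u x + v x).
Proof.
  intros Hu Hv x e He. destruct (Hu x (e / 2)) as [r [Hr HU]]; [lra|].
  destruct (Hv x (e / 2)) as [s [Hs HV]]; [lra|].
  exists (Rmin r s). split; [now apply Rmin_pos|]. intros y Hy.
  specialize (HU y (Rlt_le_trans _ _ _ Hy (Rmin_l _ _))).
  specialize (HV y (Rlt_le_trans _ _ _ Hy (Rmin_r _ _))).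
  apply Rabs_def2 in HU, HV. apply Rabs_def1; lra.
Qed.

Lemma cont_const (K : MetricSpace) (c : R) : cont K (fun _ => c).
Proof.
  intros x e He. exists 1. split; [lra|]. intros. now rewrite Rminus_diag, Rabs_R0.
Qed.

Definition bump (K : MetricSpace) (p : K) (r c : R) (x : K) : R :=
  c * Rmax 0 (1 - mdist K p x / r).

Lemma cont_bump (K : MetricSpace) (p : K) (r c : R) : 0 < r -> 0 <= c -> cont K (bump K p r c).
Proof.
  intros Hr Hc x e He. exists (r * e / (c + 1)).
  assert (Hd : 0 < r * e / (c + 1)) by (apply Rdiv_lt_0_compat; nra).
  split; [exact Hd|]. intros y Hy. unfold bump.
  rewrite <- Rmult_minus_distr_l, Rabs_mult, (Rabs_right c) by lra.
  assert (H : Rabs (Rmax 0 (1 - mdist K p x / r) - Rmax 0 (1 - mdist K p y / r)) <= mdist K x y / r).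
  { pose proof (Defs.dist_tri K p x y). pose proof (Defs.dist_tri K p y x).
    rewrite (Defs.dist_sym K y x) in H0.
    assert (Hi : 0 < / r) by now apply Rinv_0_lt_compat.
    pose proof (mdist_ge0 K x y). unfold Rdiv.
    assert (0 <= mdist K x y * / r) by (apply Rmult_le_pos; lra).
    assert (mdist K p y * / r <= mdist K p x * / r + mdist K x y * / r) by nra.
    assert (mdist K p x * / r <= mdist K p y * / r + mdist K x y * / r) by nra.
    unfold Rmax. destruct (Rle_dec _ _); destruct (Rle_dec _ _); apply Rabs_le; lra. }
  apply Rle_lt_trans with (c * (mdist K x y / r)); [now apply Rmult_le_compat_l|].
  apply (Rmult_lt_reg_r r); [exact Hr|].
  replace (c * (mdist K x y / r) * r) with (c * mdist K x y) by (field; lra).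
  apply (Rmult_lt_compat_r (c + 1)) in Hy; [|lra].
  replace (r * e / (c + 1) * (c + 1)) with (r * e) in Hy by (field; lra).
  pose proof (mdist_ge0 K x y). nra.
Qed.

Lemma bump_range (K : MetricSpace) (p : K) (r c : R) (x : K) : 0 < r -> 0 <= c ->
  0 <= bump K p r c x <= c.
Proof.
  intros Hr Hc. unfold bump.
  assert (0 <= mdist K p x / r) by (apply Rmult_le_pos; [apply mdist_ge0|left; now apply Rinv_0_lt_compat]).
  unfold Rmax. destruct (Rle_dec _ _); nra.
Qed.

Lemma bump_far (K : MetricSpace) (p : K) (r c : R) (x : K) : 0 < r -> r <= mdist K p x ->
  bump K p r c x = 0.
Proof.
  intros Hr H. unfold bump.
  assert (1 <= mdist K p x / r).
  { apply (Rmult_le_reg_r r); [exact Hr|].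
    replace (mdist K p x / r * r) with (mdist K p x) by (field; lra). lra. }
  rewrite Rmax_left by lra. ring.
Qed.

Lemma bump_center (K : MetricSpace) (p : K) (r c : R) : bump K p r c p = c.
Proof.
  unfold bump. rewrite mdist_refl. unfold Rdiv. rewrite Rmult_0_l, Rminus_0_r, Rmax_right by lra. ring.
Qed.

(** One tent function per node, so narrow that it vanishes on [F] and at the nodes treated before
    it. The maximum, unlike a sum, keeps the range in [[0, a]] where tents overlap; putting [y v]
    into the forbidden list of the induction hypothesis makes the earlier [h] vanish there. *)
Lemma interpolation (K : MetricSpace) {A : Type} (V : list A) (y : A -> K) (F : list K)
  (val : A -> R) (a : R) :
  0 <= a -> NoDup V -> (forall v v', In v V -> In v' V -> y v = y v' -> v = v') ->
  (forall v, In v V -> ~ In (y v) F) -> (forall v, In v V -> 0 <= val v <= a) ->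
  exists h, cont K h /\ (forall x, 0 <= h x <= a) /\
    (forall v, In v V -> h (y v) = val v) /\ (forall x, In x F -> h x = 0).
Proof.
  intros Ha HV. revert F. induction HV as [|v V Hv HV IH]; intros F Hinj HF Hval.
  - exists (fun _ => 0). split; [apply cont_const|]. split; [intros; lra|].
    split; [intros v []|auto].
  - destruct (IH (y v :: F)) as [h [Hc [Hr [HhV HhF]]]].
    + intros u u' Hu Hu'. apply Hinj; right; auto.
    + intros u Hu [E|E].
      * apply Hv. replace v with u; [exact Hu|]. symmetry; apply Hinj; [left|right|]; auto.
      * apply (HF u); [right|]; auto.
    + intros u Hu. apply Hval; right; auto.
    + destruct (uniform_radius (fun z s => s <= mdist K (y v) z) (F ++ map y V)) as [r [Hr0 Hr1]].
      * intros; lra.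
      * intros z Hz. exists (mdist K (y v) z). split; [|lra]. apply mdist_pos. intros E0. subst z.
        apply in_app_iff in Hz as [Hz|Hz]; [apply (HF v); [left|]; auto|].
        apply in_map_iff in Hz as [u [E Hu]]. apply Hv.
        replace v with u; [exact Hu|]. symmetry; apply Hinj; [left|right|]; auto.
      * destruct (Hval v (or_introl eq_refl)) as [Hv0 Hv1].
        exists (fun x => Rmax (h x) (bump K (y v) r (val v) x)).
        split; [|split; [|split]].
        -- apply cont_max; [exact Hc|now apply cont_bump].
        -- intros x. pose proof (bump_range K (y v) r (val v) x Hr0 Hv0). specialize (Hr x).
           unfold Rmax; destruct (Rle_dec _ _); lra.
        -- intros u [<-|Hu].
           ++ rewrite bump_center, HhF by (left; auto). now apply Rmax_right.
           ++ rewrite bump_far; [|exact Hr0|apply Hr1, in_app_iff; right; now apply in_map].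
              rewrite HhV by exact Hu. apply Rmax_left. apply Hval; right; auto.
        -- intros x Hx. rewrite HhF by (right; auto).
           rewrite bump_far; [|exact Hr0|apply Hr1, in_app_iff; auto]. now apply Rmax_left.
Qed.

(** First components are positions in [X] rather than points, so that membership in one cluster is
    tested on natural numbers. *)
Definition vertices {T : Type} (X : list T) (d m : nat) : list (nat * list nat) :=
  list_prod (seq 0 (length X)) (idx d m).

Lemma In_vertices {T : Type} (X : list T) (d m : nat) (v : nat * list nat) :
  In v (vertices X d m) <-> (fst v < length X)%nat /\ In (snd v) (idx d m).
Proof.
  unfold vertices. destruct v as [i j]. rewrite in_prod_iff, in_seq. cbn. intuition lia.
Qed.

Lemma NoDup_vertices {T : Type} (X : list T) (d m : nat) : NoDup (vertices X d m).
Proof.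
  unfold vertices. generalize (NoDup_idx d m). generalize (idx d m). intros J HJ.
  generalize (seq_NoDup (length X) 0). generalize (seq 0 (length X)). intros I HI.
  induction HI as [|i I Hi HI IH]; cbn; [constructor|].
  apply NoDup_app; [|exact IH|].
  - apply Injective_map_NoDup; [|exact HJ]. intros j j' E; now inversion E.
  - intros v Hv Hv'. apply in_map_iff in Hv as [j [<- _]].
    apply in_prod_iff in Hv' as [Hv' _]. auto.
Qed.

Lemma length_vertices {T : Type} (X : list T) (d m : nat) :
  length (vertices X d m) = (length X * m ^ d)%nat.
Proof. unfold vertices. now rewrite length_prod, length_seq, length_idx. Qed.

(* [y (i, j)] runs through a cluster near the [i]-th point of [X] on which [g] resembles
   the grid [s * j]. *)
Definition spread (K : MetricSpace) (d m : nat) (X : list K) (x0 : K) (rad s : R)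
  (g : K -> nat -> R) (y : nat * list nat -> K) : Prop :=
  (forall v, In v (vertices X d m) -> mdist K (nth (fst v) X x0) (y v) < rad) /\
  (forall v v' k, In v (vertices X d m) -> In v' (vertices X d m) -> fst v = fst v' -> (k < d)%nat ->
     s / 2 * Rabs (INR (nth k (snd v) 0%nat) - INR (nth k (snd v') 0%nat))
     <= Rabs (g (y v) k - g (y v') k)).

(** At the cluster points [G] differs from its value at the centre by less than [s / 4], so adding
    [h k] with value [j_k s] at [y (i, j)] produces the grid. Its height is below [m s <= a], which
    bounds the correction. Returning [F'] lets later stages protect the new points. *)
Lemma spread_step (K : MetricSpace) (d m : nat) (X : list K) (x0 : K) (rad s a : R)
  (G : K -> nat -> R) (F : list K) :
  inC K d G -> (forall x, In x X -> ~ isolated K x) -> 0 < rad -> 0 < s -> INR m * s <= a ->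
  exists (g : K -> nat -> R) (F' : list K) (y : nat * list nat -> K),
    inC K d g /\ (forall x i, 0 <= g x i - G x i <= a) /\
    (forall x i, In x F -> g x i = G x i) /\ incl F F' /\
    (forall v, In v (vertices X d m) -> In (y v) F') /\
    spread K d m X x0 rad s g y.
Proof.
  intros HG HX Hrad Hs Hms. apply inC_iff in HG as [G0 Gc].
  assert (Ha : 0 <= a) by (pose proof (pos_INR m); nra).
  destruct (uniform_radius (fun ik r => forall y, mdist K (nth (fst ik) X x0) y < r ->
       Rabs (G (nth (fst ik) X x0) (snd ik) - G y (snd ik)) < s / 4)
      (list_prod (seq 0 (length X)) (seq 0 d))) as [r [Hr Hosc]].
  { intros ik r r' H Hle y Hy. apply H. lra. }
  { intros [i k] _. cbn. destruct (Gc k (nth i X x0) (s / 4)) as [r [Hr H]]; [lra|].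
    exists r. split; auto. }
  destruct (distinct_points_near K (vertices X d m) (fun v => nth (fst v) X x0) (Rmin rad r) F)
    as [y [Hy Hinj]].
  { apply NoDup_vertices. }
  { intros v Hv. apply In_vertices in Hv as [Hv _]. apply HX, nth_In, Hv. }
  { now apply Rmin_pos. }
  { now constructor. }
  assert (Hh : forall k, exists h, cont K h /\ (forall x, 0 <= h x <= a) /\
     (forall v, In v (vertices X d m) -> h (y v) = if lt_dec k d then INR (nth k (snd v) 0%nat) * s else 0) /\
     (forall x, In x F -> h x = 0)).
  { intros k. apply interpolation; auto using NoDup_vertices; [intros v Hv; now apply Hy|].
    intros v Hv. destruct (lt_dec k d) as [Hk|]; [|lra].
    apply In_vertices in Hv as [_ Hv]. apply In_idx in Hv as [_ Hv]. specialize (Hv k Hk).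
    pose proof (pos_INR (nth k (snd v) 0%nat)). apply lt_INR in Hv. split; nra. }
  destruct (choice _ Hh) as [h Hh'].
  exists (fun x i => if lt_dec i d then G x i + h i x else 0), (F ++ map y (vertices X d m)), y.
  split; [|split; [|split; [|split; [|split]]]].
  - apply inC_iff. split.
    + intros x i Hi. destruct (lt_dec i d); [lia|reflexivity].
    + intros i. destruct (lt_dec i d); [|apply cont_const].
      apply cont_plus; [apply Gc|apply Hh'].
  - intros x i. destruct (lt_dec i d); [|rewrite G0 by lia; lra].
    destruct (Hh' i) as [_ [H _]]. specialize (H x). lra.
  - intros x i Hx. destruct (lt_dec i d); [|rewrite G0 by lia; lra].
    destruct (Hh' i) as [_ [_ [_ H]]]. rewrite H by exact Hx. lra.
  - intros x Hx. apply in_app_iff; auto.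
  - intros v Hv. apply in_app_iff; right. now apply in_map.
  - split.
    + intros v Hv. destruct (Hy v Hv) as [H _]. pose proof (Rmin_l rad r). lra.
    + intros v v' k Hv Hv' E Hk. destruct (lt_dec k d); [|lia].
      destruct (Hh' k) as [_ [_ [Hval _]]]. rewrite !Hval by assumption.
      destruct (lt_dec k d); [|lia].
      set (j := nth k (snd v) 0%nat). set (j' := nth k (snd v') 0%nat).
      destruct (Nat.eq_dec j j') as [->|Hne]; [rewrite Rminus_diag, Rabs_R0, Rmult_0_r; apply Rabs_pos|].
      (* Distinct digits differ by at least 1, so an error of [s / 2] costs at most half of
         [s |j - j'|]; this is the factor [s / 2] in [spread]. *)
      assert (Hj : 1 <= Rabs (INR j - INR j')).
      { rewrite !INR_IZR_INZ, <- minus_IZR, <- abs_IZR. apply IZR_le. lia. }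
      assert (Hik : In (fst v, k) (list_prod (seq 0 (length X)) (seq 0 d))).
      { apply In_vertices in Hv as [Hv _]. apply in_prod; apply in_seq; lia. }
      destruct (Hy v Hv) as [D1 _]. destruct (Hy v' Hv') as [D2 _].
      pose proof (Rmin_r rad r).
      assert (O1 := Hosc _ Hik (y v) ltac:(cbn; lra)).
      assert (O2 := Hosc _ Hik (y v') ltac:(cbn; rewrite E; lra)). cbn in O1, O2.
      replace (G (y v) k + INR j * s - (G (y v') k + INR j' * s))
        with ((INR j - INR j') * s - (G (y v') k - G (y v) k)) by ring.
      pose proof (Rabs_triang_inv ((INR j - INR j') * s) (G (y v') k - G (y v) k)) as T.
      rewrite Rabs_mult, (Rabs_right s) in T by lra.
      assert (Rabs (G (y v') k - G (y v) k) < s / 2); [|nra].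
      apply Rabs_def2 in O1, O2. apply Rabs_def1; lra.
Qed.

(** As the increments are nonnegative, the limit is a supremum, and the telescoped tail bounds the
    error. *)
Lemma increasing_telescope_limit (u : nat -> R) :
  (forall n, 0 <= u (S n) - u n <= 1 / ((INR n + 1) * (INR n + 2))) ->
  exists l, forall n, u n <= l <= u n + 1 / (INR n + 1).
Proof.
  intros Hu.
  assert (Hmono : forall n k, u n <= u (n + k)%nat).
  { intros n k. induction k as [|k IH]; [rewrite Nat.add_0_r; lra|].
    rewrite Nat.add_succ_r. specialize (Hu (n + k)%nat). lra. }
  assert (Hup : forall n k, u (n + k)%nat <= u n + 1 / (INR n + 1) - 1 / (INR (n + k) + 1)).
  { intros n k. induction k as [|k IH]; [rewrite Nat.add_0_r; lra|].
    rewrite Nat.add_succ_r, S_INR. specialize (Hu (n + k)%nat).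
    pose proof (pos_INR (n + k)).
    assert (1 / ((INR (n + k) + 1) * (INR (n + k) + 2))
            = 1 / (INR (n + k) + 1) - 1 / (INR (n + k) + 1 + 1)) by (field; lra).
    lra. }
  assert (Hub : forall n k, u k <= u n + 1 / (INR n + 1)).
  { intros n k. pose proof (pos_INR n).
    assert (Hinv : forall p, 0 < 1 / (INR p + 1))
      by (intros p; pose proof (pos_INR p); apply Rdiv_lt_0_compat; lra).
    destruct (Nat.le_ge_cases n k) as [Hle|Hle].
    - replace k with (n + (k - n))%nat by lia. specialize (Hup n (k - n)%nat).
      specialize (Hinv (n + (k - n))%nat). lra.
    - specialize (Hmono k (n - k)%nat). replace (k + (n - k))%nat with n in Hmono by lia.
      specialize (Hinv n). lra. }
  destruct (completeness (fun z => exists n, z = u n)) as [l [Hl1 Hl2]].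
  - exists (u 0%nat + 1 / (INR 0 + 1)). intros z [n ->]. apply Hub.
  - exists (u 0%nat). now exists 0%nat.
  - exists l. intros n. split; [apply Hl1; now exists n|].
    apply Hl2. intros z [k ->]. apply Hub.
Qed.

(** The list in the state gathers the cluster points used so far. Later corrections vanish on it, so
    the limit keeps there the value of the stage that introduced the point ([Hagree]), and [spread]
    passes to [g]. The corrections sum to at most 1, whence the range [[0, 1]]. *)
Lemma spread_all_scales (K : MetricSpace) (d : nat) (x0 : K) (X : nat -> list K) (m : nat -> nat)
  (rad s : nat -> R) :
  (forall n x, In x (X n) -> ~ isolated K x) ->
  (forall n, 0 < rad n) -> (forall n, 0 < s n) ->
  (forall n, INR (m n) * s n <= 1 / ((INR n + 1) * (INR n + 2))) ->
  exists g, inC K d g /\ (forall x i, 0 <= g x i <= 1) /\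
    forall n, exists y, spread K d (m n) (X n) x0 (rad n) (s n) g y.
Proof.
  intros HX Hrad Hs Hms.
  (* Continuity is a premise under the existential, so that [choice] yields a step defined on every
     state, continuous or not. *)
  assert (Hstep : forall nst : nat * ((K -> nat -> R) * list K),
     exists st' : (K -> nat -> R) * list K, inC K d (fst (snd nst)) ->
       let n := fst nst in let st := snd nst in
       inC K d (fst st') /\
       (forall x i, 0 <= fst st' x i - fst st x i <= 1 / ((INR n + 1) * (INR n + 2))) /\
       (forall x i, In x (snd st) -> fst st' x i = fst st x i) /\ incl (snd st) (snd st') /\
       exists y, (forall v, In v (vertices (X n) d (m n)) -> In (y v) (snd st')) /\
         spread K d (m n) (X n) x0 (rad n) (s n) (fst st') y).
  { intros [n [G F]]. destruct (classic (inC K d G)) as [HG|HG].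
    - destruct (spread_step K d (m n) (X n) x0 (rad n) (s n) _ G F HG (HX n) (Hrad n) (Hs n) (Hms n))
        as [g [F' [y H]]].
      exists (g, F'). intros _. cbn. repeat split; try apply H. exists y. split; apply H.
    - exists (G, F). tauto. }
  destruct (choice _ Hstep) as [step Hst].
  set (st := fix st n := match n with O => (fun _ _ => 0, []) | S n => step (n, st n) end).
  assert (HC : forall n, inC K d (fst (st n))).
  { induction n as [|n IH].
    - apply inC_iff. split; [reflexivity|intros i; exact (cont_const K 0)].
    - apply (Hst (n, st n)), IH. }
  assert (HS : forall n, inC K d (fst (st (S n))) /\
       (forall x i, 0 <= fst (st (S n)) x i - fst (st n) x i <= 1 / ((INR n + 1) * (INR n + 2))) /\
       (forall x i, In x (snd (st n)) -> fst (st (S n)) x i = fst (st n) x i) /\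
       incl (snd (st n)) (snd (st (S n))) /\
       exists y, (forall v, In v (vertices (X n) d (m n)) -> In (y v) (snd (st (S n)))) /\
         spread K d (m n) (X n) x0 (rad n) (s n) (fst (st (S n))) y)
    by (intros n; exact (Hst (n, st n) (HC n))).
  assert (Hlim : forall xi : K * nat, exists l, forall n,
     fst (st n) (fst xi) (snd xi) <= l <= fst (st n) (fst xi) (snd xi) + 1 / (INR n + 1)).
  { intros [x i]. apply (increasing_telescope_limit (fun n => fst (st n) x i)).
    intros n. apply HS. }
  destruct (choice _ Hlim) as [g0 Hg0].
  set (g := fun x i => g0 (x, i)).
  assert (Hg : forall x i n, fst (st n) x i <= g x i <= fst (st n) x i + 1 / (INR n + 1))
    by (intros x i n; apply (Hg0 (x, i) n)).
  assert (Hagree : forall n x i, In x (snd (st n)) -> g x i = fst (st n) x i).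
  { intros n x i Hx.
    assert (Hk : forall k, In x (snd (st (n + k)%nat)) /\ fst (st (n + k)%nat) x i = fst (st n) x i).
    { induction k as [|k [IH1 IH2]]; [rewrite Nat.add_0_r; auto|].
      rewrite Nat.add_succ_r. destruct (HS (n + k)%nat) as [_ [_ [H1 [H2 _]]]].
      split; [now apply H2|]. now rewrite H1. }
    (* The stages agree at [x] from [n] on, while [g] exceeds stage [n + k] by at most
       [1 / (n + k + 1)] for every [k]. *)
    apply Rle_antisym; [|apply Hg].
    apply Rnot_lt_le; intros Hlt.
    destruct (INR_unbounded (1 / (g x i - fst (st n) x i))) as [k Hkk].
    destruct (Hk k) as [_ E]. pose proof (Hg x i (n + k)%nat) as [_ H]. rewrite E in H.
    rewrite plus_INR in H. pose proof (pos_INR n). pose proof (pos_INR k).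
    set (z := g x i - fst (st n) x i) in *. assert (Hz : 0 < z) by (unfold z; lra).
    assert (Hz1 : z <= 1 / (INR n + INR k + 1)) by (unfold z; lra).
    apply (Rmult_lt_compat_r z) in Hkk; [|exact Hz].
    replace (1 / z * z) with 1 in Hkk by (field; lra).
    apply (Rmult_le_compat_r (INR n + INR k + 1)) in Hz1; [|lra].
    replace (1 / (INR n + INR k + 1) * (INR n + INR k + 1)) with 1 in Hz1 by (field; lra). nra. }
  exists g. split; [|split].
  - apply inC_iff. split.
    + intros x i Hi. assert (H : forall n, fst (st n) x i = 0).
      { intros n. now apply (proj1 (proj1 (inC_iff K d _) (HC n))). }
      apply Rle_antisym.
      * apply Rnot_lt_le; intros Hlt.
        destruct (INR_unbounded (1 / g x i)) as [k Hk]. pose proof (Hg x i k) as [_ H1].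
        rewrite H in H1. pose proof (pos_INR k).
        apply (Rmult_lt_compat_r (g x i)) in Hk; [|exact Hlt].
        replace (1 / g x i * g x i) with 1 in Hk by (field; lra).
        apply (Rmult_le_compat_r (INR k + 1)) in H1; [|lra].
        replace ((0 + 1 / (INR k + 1)) * (INR k + 1)) with 1 in H1 by (field; lra). nra.
      * specialize (Hg x i 0%nat). rewrite H in Hg. lra.
    + intros i x e He. destruct (INR_unbounded (4 / e)) as [n Hn].
      pose proof (pos_INR n).
      assert (Hne : 1 / (INR n + 1) <= e / 4).
      { apply (Rmult_le_reg_r (INR n + 1)); [lra|].
        replace (1 / (INR n + 1) * (INR n + 1)) with 1 by (field; lra).
        apply (Rmult_lt_compat_l e) in Hn; [|lra].
        replace (e * (4 / e)) with 4 in Hn by (field; lra). nra. }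
      destruct (proj2 (proj1 (inC_iff K d _) (HC n)) i x (e / 4)) as [r [Hr Hc]]; [lra|].
      exists r. split; [exact Hr|]. intros y Hy. specialize (Hc y Hy).
      pose proof (Hg x i n). pose proof (Hg y i n).
      apply Rabs_def2 in Hc. apply Rabs_def1; lra.
  - intros x i. specialize (Hg x i 0%nat). cbn in Hg. lra.
  - intros n. destruct (HS n) as [_ [_ [_ [_ [y [Hy [S1 S2]]]]]]]. exists y. split; [exact S1|].
    intros v v' k Hv Hv' E Hk. rewrite !(Hagree (S n)) by (apply Hy; assumption). now apply S2.
Qed.

(** * Random perturbations along the probe *)

Definition scale_coords {K : MetricSpace} (g : K -> nat -> R) (t : nat -> R) : K -> nat -> R :=
  fun x i => t i * g x i.

Lemma inC_scale_coords (K : MetricSpace) (d : nat) (g : K -> nat -> R) (t : nat -> R) :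
  inC K d g -> inC K d (scale_coords g t).
Proof.
  rewrite !inC_iff. intros [G0 Gc]. unfold scale_coords. split.
  - intros x i Hi. rewrite G0 by exact Hi. ring.
  - intros i x e He. pose proof (Rabs_pos (t i)).
    destruct (Gc i x (e / (Rabs (t i) + 1))) as [r [Hr H1]]; [apply Rdiv_lt_0_compat; lra|].
    exists r. split; [exact Hr|]. intros y Hy. specialize (H1 y Hy).
    rewrite <- Rmult_minus_distr_l, Rabs_mult.
    apply (Rmult_lt_compat_r (Rabs (t i) + 1)) in H1; [|lra].
    replace (e / (Rabs (t i) + 1) * (Rabs (t i) + 1)) with e in H1 by (field; lra).
    pose proof (Rabs_pos (g x i - g y i)). nra.
Qed.

Lemma event_lt (O : prob_space) (u : O -> R) (c : R) :
  (forall c, event O (fun w => u w <= c)) -> event O (fun w => u w < c).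
Proof.
  intros Hu. apply (event_iff O (fun w => exists n : nat, u w <= c - / (INR n + 1))).
  - intros w. split.
    + intros [n Hn]. pose proof (pos_INR n).
      assert (0 < / (INR n + 1)) by (apply Rinv_0_lt_compat; lra). lra.
    + intros H. destruct (INR_unbounded (/ (c - u w))) as [n Hn]. exists n.
      assert (Hp : 0 < / (c - u w)) by (apply Rinv_0_lt_compat; lra).
      assert (/ (INR n + 1) <= c - u w); [|lra].
      rewrite <- (Rinv_inv (c - u w)). apply Rinv_le_contravar; lra.
  - now apply event_union.
Qed.

Lemma event_Icc (O : prob_space) (u : O -> R) (a b : R) :
  (forall c, event O (fun w => u w <= c)) -> event O (fun w => a <= u w <= b).
Proof.
  intros Hu. apply event_and; [|apply Hu].
  apply (event_iff O (fun w => ~ u w < a)); [intros w; lra|].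
  now apply event_compl, event_lt.
Qed.

Lemma event_Int_part (O : prob_space) (u : O -> R) (N : nat) (z : Z) :
  (forall c, event O (fun w => u w <= c)) -> event O (fun w => Int_part (2 ^ N * u w) = z).
Proof.
  intros Hu. assert (H2 : 0 < 2 ^ N) by (apply pow_lt; lra).
  apply (event_iff O (fun w => ~ u w < IZR z / 2 ^ N /\ u w < (IZR z + 1) / 2 ^ N)).
  - intros w.
    assert (A : u w < IZR z / 2 ^ N <-> 2 ^ N * u w < IZR z).
    { split; intros H.
      - apply (Rmult_lt_compat_l (2 ^ N)) in H; [|exact H2].
        replace (2 ^ N * (IZR z / 2 ^ N)) with (IZR z) in H by (field; lra). exact H.
      - apply (Rmult_lt_reg_l (2 ^ N)); [exact H2|].
        replace (2 ^ N * (IZR z / 2 ^ N)) with (IZR z) by (field; lra). exact H. }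
    assert (B : u w < (IZR z + 1) / 2 ^ N <-> 2 ^ N * u w < IZR z + 1).
    { split; intros H.
      - apply (Rmult_lt_compat_l (2 ^ N)) in H; [|exact H2].
        replace (2 ^ N * ((IZR z + 1) / 2 ^ N)) with (IZR z + 1) in H by (field; lra). exact H.
      - apply (Rmult_lt_reg_l (2 ^ N)); [exact H2|].
        replace (2 ^ N * ((IZR z + 1) / 2 ^ N)) with (IZR z + 1) by (field; lra). exact H. }
    rewrite A, B. split.
    + intros [H H']. symmetry. apply Int_part_spec. lra.
    + intros <-. destruct (base_Int_part (2 ^ N * u w)). lra.
  - apply event_and; [apply event_compl|]; now apply event_lt.
Qed.

(** [Q] is arbitrary: there are only countably many lists of values, and taking each of them is an
    event. The natural number [n] enumerates the integers as [n] and [-n]. *)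
Lemma event_Z_valued (O : prob_space) (v : nat -> O -> Z) (l : list nat) (Q : list Z -> Prop) :
  (forall k z, event O (fun w => v k w = z)) -> event O (fun w => Q (map (fun k => v k w) l)).
Proof.
  intros Hv. revert Q. induction l as [|k l IH]; intros Q; [exact (event_const O (Q []))|].
  apply (event_iff O (fun w => exists n : nat,
     (v k w = Z.of_nat n /\ Q (Z.of_nat n :: map (fun k => v k w) l)) \/
     (v k w = (- Z.of_nat n)%Z /\ Q ((- Z.of_nat n)%Z :: map (fun k => v k w) l)))).
  - intros w. cbn [map]. split.
    + intros [n [[E H]|[E H]]]; rewrite E; exact H.
    + intros H. exists (Z.abs_nat (v k w)). rewrite Zabs2Nat.id_abs.
      destruct (Z.abs_eq_or_opp (v k w)) as [E|E]; rewrite E.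
      * left; auto.
      * right. rewrite Z.opp_involutive; auto.
  - apply event_union. intros n. apply event_or; (apply event_and; [apply Hv|]).
    + exact (IH (fun zs => Q (Z.of_nat n :: zs))).
    + exact (IH (fun zs => Q ((- Z.of_nat n)%Z :: zs))).
Qed.

(* An open set is a union of dyadic boxes, a box being coded by the integer parts of [2 ^ N * t]. *)
Lemma event_supopen (K : MetricSpace) (d : nat) (O : prob_space) (t : nat -> O -> R)
  (g : K -> nat -> R) (U : (K -> nat -> R) -> Prop) :
  (forall k c, event O (fun w => t k w <= c)) -> inC K d g -> (forall x i, 0 <= g x i <= 1) ->
  supopen K d U -> event O (fun w => U (scale_coords g (fun i => t i w))).
Proof.
  intros Ht Hg Hb HU.
  set (phi := fun w => scale_coords g (fun i => t i w)).
  set (dig := fun N w => map (fun k => Int_part (2 ^ N * t k w)) (seq 0 d)).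
  apply (event_iff O (fun w => exists N, forall w', dig N w' = dig N w -> U (phi w'))).
  - intros w. split; [intros [N H]; now apply H|]. intros H.
    destruct (HU (phi w) (inC_scale_coords K d g _ Hg) H) as [r [Hr HrU]].
    destruct (INR_unbounded (INR d / r)) as [N HN]. exists N. intros w' E.
    apply HrU; [now apply inC_scale_coords|]. intros x.
    assert (H2 : 0 < 2 ^ N) by (apply pow_lt; lra).
    apply Rle_trans with (INR d * / 2 ^ N).
    + apply eucl_le; [left; now apply Rinv_0_lt_compat|]. intros k Hk.
      unfold vsub, phi, scale_coords. rewrite <- Rmult_minus_distr_r, Rabs_mult.
      rewrite (Rabs_right (g x k)) by (specialize (Hb x k); lra).
      assert (Ek : Int_part (2 ^ N * t k w') = Int_part (2 ^ N * t k w)).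
      { assert (Hn : forall w, nth k (dig N w) 0%Z = Int_part (2 ^ N * t k w)).
        { intros w0. unfold dig.
          rewrite (nth_indep _ 0%Z (Int_part (2 ^ N * t 0%nat w0))) by (rewrite length_map, length_seq; exact Hk).
          rewrite (map_nth (fun k => Int_part (2 ^ N * t k w0))), seq_nth by exact Hk. reflexivity. }
        rewrite <- !Hn. now rewrite E. }
      assert (D : Rabs (t k w - t k w') <= / 2 ^ N).
      { destruct (base_Int_part (2 ^ N * t k w)). destruct (base_Int_part (2 ^ N * t k w')).
        rewrite Ek in *.
        apply (Rmult_le_reg_l (2 ^ N)); [exact H2|]. rewrite Rinv_r by lra.
        rewrite <- (Rabs_right (2 ^ N)) at 1 by lra. rewrite <- Rabs_mult.
        apply Rabs_le. lra. }
      specialize (Hb x k). pose proof (Rabs_pos (t k w - t k w')). nra.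
    + assert (H2N : INR N <= 2 ^ N).
      { rewrite <- (pow_INR 2). apply le_INR. pose proof (Nat.pow_gt_lin_r 2 N). lia. }
      apply (Rmult_le_reg_r (2 ^ N)); [exact H2|].
      rewrite Rmult_assoc, Rinv_l, Rmult_1_r by lra.
      apply (Rmult_lt_compat_l r) in HN; [|lra].
      replace (r * (INR d / r)) with (INR d) in HN by (field; lra). nra.
  - apply event_union. intros N.
    apply (event_Z_valued O (fun k w => Int_part (2 ^ N * t k w)) (seq 0 d)
             (fun zs => forall w', dig N w' = zs -> U (phi w'))).
    intros k z. now apply event_Int_part.
Qed.

Lemma event_borel (K : MetricSpace) (d : nat) (O : prob_space) (t : nat -> O -> R)
  (g : K -> nat -> R) (B : (K -> nat -> R) -> Prop) :
  (forall k c, event O (fun w => t k w <= c)) -> inC K d g -> (forall x i, 0 <= g x i <= 1) ->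
  borel K d B -> event O (fun w => B (scale_coords g (fun i => t i w))).
Proof.
  intros Ht Hg Hb HB. induction HB as [U HU|B HB IH|Bs HB IH|B B' HB IH HE].
  - now apply (event_supopen K d).
  - now apply event_compl.
  - now apply event_union.
  - apply (event_iff O _ _ (fun w => HE _ (inC_scale_coords K d g _ Hg)) IH).
Qed.

Lemma pushforward_borel_prob_measure (K : MetricSpace) (d : nat) (O : prob_space)
  (t : nat -> O -> R) (g : K -> nat -> R) :
  (forall k c, event O (fun w => t k w <= c)) -> inC K d g -> (forall x i, 0 <= g x i <= 1) ->
  borel_prob_measure K d (fun B => pr O (fun w => B (scale_coords g (fun i => t i w)))).
Proof.
  intros Ht Hg Hb. split; [|split; [|split]].
  - intros B B' _ HE. f_equal. apply pred_ext. intros w. now apply HE, inC_scale_coords.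
  - intros B HB. now apply pr_ge0, (event_borel K d).
  - apply pr_full.
  - intros Bs HB HD. apply (pr_sigma O (fun n w => Bs n (scale_coords g (fun i => t i w)))).
    + intros n. now apply (event_borel K d).
    + intros i j w Hij. now apply (HD i j _ Hij), inC_scale_coords.
Qed.

(** * Close pairs in a cluster and their probability *)

(** Pairs from different clusters never count, since their distance in [K] already separates them.
    The inequality is not strict, so its failure is an open condition on [f]. *)
Definition close {K : MetricSpace} (d : nat) (delta : R) (y : nat * list nat -> K)
  (f : K -> nat -> R) (v v' : nat * list nat) : Prop :=
  fst v = fst v' /\ forall k, (k < d)%nat -> Rabs (f (y v) k - f (y v') k) <= delta.

Definition scattered {K : MetricSpace} (d : nat) (delta : R) (V : list (nat * list nat))
  (y : nat * list nat -> K) (f : K -> nat -> R) : Prop :=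
  (2 * count (fun p => close d delta y f (fst p) (snd p)) (pairs V) <= length V)%nat.

(** Failing to be close survives small uniform perturbations, so near [f] the number of close pairs
    cannot increase. *)
Lemma supopen_scattered (K : MetricSpace) (d : nat) (delta : R) (V : list (nat * list nat))
  (y : nat * list nat -> K) : supopen K d (scattered d delta V y).
Proof.
  intros f Hf HG.
  destruct (uniform_radius (fun p r => forall h : K -> nat -> R,
      (forall x, eucl d (vsub (f x) (h x)) <= r) ->
      close d delta y h (fst p) (snd p) -> close d delta y f (fst p) (snd p)) (pairs V))
    as [r [Hr HQ]].
  - intros p r s H Hs h Hh. apply H. intros x. specialize (Hh x). lra.
  - intros [v v'] _. cbn. destruct (classic (close d delta y f v v')) as [Hc|Hc].
    + exists 1. split; [lra|auto].
    + destruct (classic (fst v = fst v')) as [E|E].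
      2:{ exists 1. split; [lra|]. intros h _ [E' _]. tauto. }
      assert (Hk : exists k, (k < d)%nat /\ delta < Rabs (f (y v) k - f (y v') k)).
      { apply NNPP; intros Hno. apply Hc. split; [exact E|]. intros k Hk.
        apply Rnot_lt_le; intros Hlt. apply Hno; eauto. }
      destruct Hk as [k [Hk Hlt]].
      (* Each of the two values moves by at most a third of the gap, so their difference stays above
         [delta]. *)
      exists ((Rabs (f (y v) k - f (y v') k) - delta) / 3). split; [lra|].
      intros h Hh [_ Hch]. exfalso. specialize (Hch k Hk).
      pose proof (Rle_trans _ _ _ (Rabs_le_eucl d k (vsub (f (y v)) (h (y v))) Hk) (Hh (y v))) as D1.
      pose proof (Rle_trans _ _ _ (Rabs_le_eucl d k (vsub (f (y v')) (h (y v'))) Hk) (Hh (y v'))) as D2.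
      unfold vsub in D1, D2.
      set (A := Rabs (f (y v) k - f (y v') k)) in *.
      assert (A <= Rabs (f (y v) k - h (y v) k) + Rabs (h (y v) k - h (y v') k) + Rabs (f (y v') k - h (y v') k)).
      { unfold A. rewrite (Rabs_minus_sym (f (y v') k)).
        replace (f (y v) k - f (y v') k) with
          ((f (y v) k - h (y v) k) + (h (y v) k - h (y v') k) + (h (y v') k - f (y v') k)) by ring.
        eapply Rle_trans; [apply Rabs_triang|]. apply Rplus_le_compat_r, Rabs_triang. }
      lra.
  - exists r. split; [exact Hr|]. intros h Hh Hd. unfold scattered in *.
    eapply Nat.le_trans; [|exact HG]. apply Nat.mul_le_mono_l, count_le.
    intros p Hp. apply (HQ p Hp h Hd).
Qed.

(** In one coordinate, closeness confines [t] to an interval of length [2 delta / |D|]; its centre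
    [c / D] carries all the dependence on the translate. *)
Lemma Rabs_affine_le_iff (t D c delta : R) : D <> 0 ->
  (Rabs (t * D - c) <= delta <-> c / D - delta / Rabs D <= t <= c / D + delta / Rabs D).
Proof.
  intros HD. assert (HDp : 0 < Rabs D) by now apply Rabs_pos_lt.
  assert (E : Rabs (t * D - c) = Rabs (t - c / D) * Rabs D)
    by (rewrite <- Rabs_mult; f_equal; field; exact HD).
  rewrite E. split.
  - intros H. assert (H' : Rabs (t - c / D) <= delta / Rabs D).
    { apply (Rmult_le_reg_r (Rabs D)); [exact HDp|].
      replace (delta / Rabs D * Rabs D) with delta by (field; lra). exact H. }
    set (q := delta / Rabs D) in *. clearbody q. unfold Rabs in H'. destruct (Rcase_abs _); lra.
  - intros H. replace delta with (delta / Rabs D * Rabs D) by (field; lra).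
    apply Rmult_le_compat_r; [lra|]. apply Rabs_le. lra.
Qed.

Lemma event_close (K : MetricSpace) (d : nat) (O : prob_space) (t : nat -> O -> R)
  (g x : K -> nat -> R) (delta : R) (y : nat * list nat -> K) (v v' : nat * list nat) :
  (forall k c, event O (fun w => t k w <= c)) ->
  event O (fun w => close d delta y (fsub (scale_coords g (fun i => t i w)) x) v v').
Proof.
  intros Ht. apply event_and; [apply event_const|].
  apply event_inter. intros k. apply event_impl. intros _.
  set (D := g (y v) k - g (y v') k). set (c := x (y v) k - x (y v') k).
  apply (event_iff O (fun w => Rabs (t k w * D - c) <= delta)).
  { intros w. unfold fsub, scale_coords.
    replace (t k w * D - c) with (t k w * g (y v) k - x (y v) k - (t k w * g (y v') k - x (y v') k))
      by (unfold D, c; ring). reflexivity. }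
  destruct (Req_dec D 0) as [->|HD].
  - apply (event_iff O (fun _ => Rabs (0 - c) <= delta)); [|apply event_const].
    intros w. rewrite Rmult_0_r. reflexivity.
  - apply (event_iff O (fun w => c / D - delta / Rabs D <= t k w <= c / D + delta / Rabs D)).
    + intros w. now rewrite Rabs_affine_le_iff.
    + now apply event_Icc.
Qed.

Lemma event_scattered (K : MetricSpace) (d : nat) (O : prob_space) (t : nat -> O -> R)
  (g x : K -> nat -> R) (delta : R) (V : list (nat * list nat)) (y : nat * list nat -> K) :
  (forall k c, event O (fun w => t k w <= c)) ->
  event O (fun w => scattered d delta V y (fsub (scale_coords g (fun i => t i w)) x)).
Proof.
  intros Ht.
  (* For [L] vertices, [2 c <= L] is the negation of [L / 2 + 1 <= c]; the same threshold is used in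
     Markov's inequality below. *)
  apply (event_iff O (fun w => ~ (S (length V / 2) <= count (fun p =>
     close d delta y (fsub (scale_coords g (fun i => t i w)) x) (fst p) (snd p)) (pairs V))%nat)).
  - intros w. unfold scattered. set (n := count _ _).
    pose proof (Nat.div_mod (length V) 2 ltac:(lia)).
    pose proof (Nat.mod_upper_bound (length V) 2 ltac:(lia)). lia.
  - apply event_compl.
    apply (event_count O (fun p w => close d delta y (fsub (scale_coords g (fun i => t i w)) x) (fst p) (snd p))).
    intros p. now apply event_close.
Qed.

(** Bound for the probability that [v] and [v'] are close, with [c = 4 delta / s]; a coordinate in
    which the digits agree gives no information and contributes 1. *)
Definition close_weight (d : nat) (c : R) (v v' : nat * list nat) : R :=
  if Nat.eq_dec (fst v) (fst v') then
    prodR d (fun k => if Nat.eq_dec (nth k (snd v) 0%nat) (nth k (snd v') 0%nat) then 1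
      else c / Rabs (INR (nth k (snd v) 0%nat) - INR (nth k (snd v') 0%nat)))
  else 0.

Lemma close_weight_ge0 (d : nat) (c : R) (v v' : nat * list nat) : 0 <= c ->
  0 <= close_weight d c v v'.
Proof.
  intros Hc. unfold close_weight. destruct (Nat.eq_dec (fst v) (fst v')); [|lra].
  apply prodR_ge0. intros k _. destruct (Nat.eq_dec _ _) as [|Hne]; [lra|].
  apply Rmult_le_pos; [exact Hc|]. left. apply Rinv_0_lt_compat, Rabs_pos_lt.
  intros E. apply Hne, INR_eq. lra.
Qed.

Lemma close_weight_refl (d : nat) (c : R) (v : nat * list nat) : close_weight d c v v = 1.
Proof.
  unfold close_weight. destruct (Nat.eq_dec (fst v) (fst v)) as [_|]; [|tauto].
  transitivity (prodR d (fun _ => 1)); [|rewrite prodR_const; apply pow1].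
  f_equal. apply functional_extensionality. intros k.
  destruct (Nat.eq_dec _ _); tauto.
Qed.

Lemma sum_list_prod {A B : Type} (u : A * B -> R) (l : list A) (l' : list B) :
  sum_list u (list_prod l l') = sum_list (fun a => sum_list (fun b => u (a, b)) l') l.
Proof.
  induction l as [|a l IH]; [reflexivity|].
  cbn [list_prod]. rewrite sum_list_app, sum_list_map, sum_list_cons, IH. reflexivity.
Qed.

Lemma sum_list_single_le (a : nat) (S : R) (l : list nat) : 0 <= S -> NoDup l ->
  sum_list (fun b => if Nat.eq_dec a b then S else 0) l <= S.
Proof.
  intros HS Hl. induction Hl as [|b l Hb Hl IH]; [cbn; lra|].
  rewrite sum_list_cons. destruct (Nat.eq_dec a b) as [->|]; [|lra].
  rewrite (sum_list_ext _ (fun _ => 0)); [rewrite sum_list_const; lra|].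
  intros a Ha. destruct (Nat.eq_dec b a) as [->|]; [tauto|reflexivity].
Qed.

(** Only the cluster of [v] contributes, so the bound does not grow with the length of [X]. *)
Lemma sum_close_weight_le {T : Type} (X : list T) (d m : nat) (c z : R) (v : nat * list nat) :
  0 <= c -> 2 * c * harm m <= z -> 0 <= z <= 1 -> In v (vertices X d m) ->
  sum_list (close_weight d c v) (vertices X d m) <= 1 + (2 ^ d - 1) * z.
Proof.
  intros Hc Hh Hz Hv. apply In_vertices in Hv as [_ Hj].
  unfold vertices. rewrite sum_list_prod.
  assert (H1 : 1 <= 2 ^ d) by (apply pow_R1_Rle; lra).
  eapply Rle_trans; [|apply (sum_list_single_le (fst v) _ (seq 0 (length X))); [nra|apply seq_NoDup]].
  apply sum_list_le. intros i _. unfold close_weight. cbn [fst snd].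
  destruct (Nat.eq_dec (fst v) i).
  - now apply (sum_idx_inv_dist_le c z d m (snd v)).
  - rewrite sum_list_const. lra.
Qed.

(** Where the digits differ, [spread] gives [|D k| >= (s / 2) |j_k - j'_k|], so [t k] lies in an
    interval of length at most [4 delta / (s |j_k - j'_k|)]. The flags [use] drop the coordinates
    with equal digits, for which [spread] offers no interval. *)
Lemma pr_close_le (K : MetricSpace) (d m : nat) (X : list K) (x0 : K) (rad s delta : R)
  (O : prob_space) (t : nat -> O -> R) (g x : K -> nat -> R) (y : nat * list nat -> K)
  (v v' : nat * list nat) :
  (forall k c, event O (fun w => t k w <= c)) ->
  (forall (use : nat -> bool) (a b : nat -> R), (forall k, a k <= b k) ->
      pr O (fun w => forall k, (k < d)%nat -> use k = true -> a k <= t k w <= b k)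
      <= prodR d (fun k => if use k then b k - a k else 1)) ->
  spread K d m X x0 rad s g y -> 0 < s -> 0 <= delta ->
  In v (vertices X d m) -> In v' (vertices X d m) ->
  pr O (fun w => close d delta y (fsub (scale_coords g (fun i => t i w)) x) v v')
  <= close_weight d (4 * delta / s) v v'.
Proof.
  intros Ht Hbox [_ Hsp] Hs Hdelta Hv Hv'. unfold close_weight.
  destruct (Nat.eq_dec (fst v) (fst v')) as [E|E].
  2:{ apply Req_le. rewrite <- (pr_empty O). f_equal. apply pred_ext. intros w.
      split; [|tauto]. intros [E' _]. tauto. }
  set (D := fun k => g (y v) k - g (y v') k).
  set (c := fun k => x (y v) k - x (y v') k).
  set (use := fun k => if Nat.eq_dec (nth k (snd v) 0%nat) (nth k (snd v') 0%nat) then false else true).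
  set (h := fun k => if use k then delta / Rabs (D k) else 0).
  assert (HD : forall k, (k < d)%nat -> use k = true -> D k <> 0 /\
     0 < Rabs (INR (nth k (snd v) 0%nat) - INR (nth k (snd v') 0%nat)) /\
     s / 2 * Rabs (INR (nth k (snd v) 0%nat) - INR (nth k (snd v') 0%nat)) <= Rabs (D k)).
  { intros k Hk. unfold use. destruct (Nat.eq_dec _ _) as [|Hne]; [easy|]. intros _.
    specialize (Hsp v v' k Hv Hv' E Hk). fold (D k) in Hsp.
    assert (Hp : 0 < Rabs (INR (nth k (snd v) 0%nat) - INR (nth k (snd v') 0%nat))).
    { apply Rabs_pos_lt. intros E'. apply Hne, INR_eq. lra. }
    split; [|auto]. intros E'. rewrite E', Rabs_R0 in Hsp. nra. }
  (* For [k >= d] nothing is known about [D k]; if it is 0, the convention [/ 0 = 0] still gives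
     [0 <= h k]. *)
  assert (Hh : forall k, 0 <= h k).
  { intros k. unfold h. destruct (use k); [|lra].
    apply Rmult_le_pos; [exact Hdelta|]. destruct (Req_dec (D k) 0) as [->|Hne].
    - rewrite Rabs_R0, Rinv_0. lra.
    - left. now apply Rinv_0_lt_compat, Rabs_pos_lt. }
  eapply Rle_trans; [eapply Rle_trans|].
  2:{ apply (Hbox use (fun k => c k / D k - h k) (fun k => c k / D k + h k)).
      intros k. specialize (Hh k). lra. }
  - apply pr_mono.
    + now apply event_close.
    + apply event_inter. intros k. apply event_impl. intros _. apply event_impl. intros _.
      now apply event_Icc.
    + intros w [_ H] k Hk Hu. destruct (HD k Hk Hu) as [HD0 _].
      unfold h. rewrite Hu. apply Rabs_affine_le_iff; [exact HD0|].
      specialize (H k Hk). unfold fsub, scale_coords in H. unfold D, c.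
      replace (t k w * (g (y v) k - g (y v') k) - (x (y v) k - x (y v') k))
        with (t k w * g (y v) k - x (y v) k - (t k w * g (y v') k - x (y v') k)) by ring.
      exact H.
  - apply prodR_le. intros k Hk. specialize (HD k Hk). unfold h, use in *.
    destruct (Nat.eq_dec (nth k (snd v) 0%nat) (nth k (snd v') 0%nat)); [lra|].
    destruct (HD eq_refl) as [HD0 [Hp Hle]].
    assert (HDp : 0 < Rabs (D k)) by now apply Rabs_pos_lt.
    set (r := Rabs (INR (nth k (snd v) 0%nat) - INR (nth k (snd v') 0%nat))) in *.
    assert (Hi : / Rabs (D k) <= / (s / 2 * r)) by (apply Rinv_le_contravar; [nra|exact Hle]).
    assert (Hi0 : 0 < / Rabs (D k)) by now apply Rinv_0_lt_compat.
    replace (4 * delta / s / r) with (2 * delta * / (s / 2 * r)) by (field; lra).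
    replace (c k / D k + delta / Rabs (D k) - (c k / D k - delta / Rabs (D k)))
      with (2 * delta * / Rabs (D k)) by (unfold Rdiv; ring).
    split; [nra|]. apply Rmult_le_compat_l; lra.
Qed.

(** With [L] vertices the expected number of close pairs is at most [L (2^d - 1) z], and Markov's
    inequality divides it by at least [L / 2]. The number of vertices cancels, so the growth of the
    packing numbers of [K] does not enter. *)
Lemma pr_not_scattered_le (K : MetricSpace) (d m : nat) (X : list K) (x0 : K) (rad s delta z : R)
  (O : prob_space) (t : nat -> O -> R) (g x : K -> nat -> R) (y : nat * list nat -> K) :
  (forall k c, event O (fun w => t k w <= c)) ->
  (forall (use : nat -> bool) (a b : nat -> R), (forall k, a k <= b k) ->
      pr O (fun w => forall k, (k < d)%nat -> use k = true -> a k <= t k w <= b k)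
      <= prodR d (fun k => if use k then b k - a k else 1)) ->
  spread K d m X x0 rad s g y -> 0 < s -> 0 <= delta ->
  2 * (4 * delta / s) * harm m <= z -> 0 <= z <= 1 ->
  pr O (fun w => ~ scattered d delta (vertices X d m) y (fsub (scale_coords g (fun i => t i w)) x))
  <= 2 * (2 ^ d - 1) * z.
Proof.
  intros Ht Hbox Hsp Hs Hdelta Hz Hz1.
  set (V := vertices X d m). set (c := 4 * delta / s) in *.
  assert (Hc : 0 <= c) by (apply Rmult_le_pos; [lra|left; now apply Rinv_0_lt_compat]).
  set (E := fun (p : (nat * list nat) * (nat * list nat)) (w : O) =>
     close d delta y (fsub (scale_coords g (fun i => t i w)) x) (fst p) (snd p)).
  set (k := S (length V / 2)).
  assert (HE : forall p, event O (E p)) by (intros p; now apply event_close).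
  pose proof (pr_count_ge O E (pairs V) (fun _ => True) k HE (event_full O)) as HM.
  cbv beta in HM.
  rewrite (pred_ext (fun w => True /\ (k <= count (fun a => E a w) (pairs V))%nat)
     (fun w => ~ scattered d delta V y (fsub (scale_coords g (fun i => t i w)) x))) in HM.
  2:{ intros w. unfold scattered, E, k. set (n := count _ _).
      pose proof (Nat.div_mod (length V) 2 ltac:(lia)). pose proof (Nat.mod_upper_bound (length V) 2 ltac:(lia)).
      split; [intros [_ H1]; lia|intros H1; split; [auto|lia]]. }
  set (P := pr O _) in *.
  assert (HS : sum_list (fun p => pr O (fun w => True /\ E p w)) (pairs V) <= INR (length V) * ((2 ^ d - 1) * z)).
  { eapply Rle_trans.
    - apply (sum_list_le _ (fun p => close_weight d c (fst p) (snd p))). intros [v v'] Hp.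
      rewrite (pred_ext (fun w => True /\ E (v, v') w) (E (v, v'))) by tauto.
      apply In_pairs in Hp as [Hv Hv']. now apply (pr_close_le K d m X x0 rad s delta O t g x y v v').
    - eapply Rle_trans; [apply sum_pairs_le; intros; now apply close_weight_ge0|].
      rewrite <- sum_list_const. apply sum_list_le. intros v Hv. rewrite close_weight_refl.
      pose proof (sum_close_weight_le X d m c z v Hc Hz Hz1 Hv). fold V in H. lra. }
  assert (Hk : INR (length V) <= 2 * INR k).
  { replace 2 with (INR 2) by reflexivity. rewrite <- mult_INR. apply le_INR. unfold k.
    pose proof (Nat.div_mod (length V) 2 ltac:(lia)). pose proof (Nat.mod_upper_bound (length V) 2 ltac:(lia)). lia. }
  assert (Hk0 : 0 < INR k) by (apply lt_0_INR; unfold k; lia).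
  assert (H1 : 1 <= 2 ^ d) by (apply pow_R1_Rle; lra).
  assert (Hz2 : 0 <= (2 ^ d - 1) * z) by nra.
  apply (Rmult_le_reg_l (INR k)); [exact Hk0|].
  eapply Rle_trans; [exact HM|]. eapply Rle_trans; [exact HS|].
  replace (INR k * (2 * (2 ^ d - 1) * z)) with (2 * INR k * ((2 ^ d - 1) * z)) by ring.
  now apply Rmult_le_compat_r.
Qed.

(** Inside a cluster, failure of [close] gives a coordinate differing by more than [2^-(n+1)].
    Across clusters the centres are more than [2^-n] apart and each point strays by less than a
    quarter of that, which again leaves [2^-(n+1)]; hence the radius [2^-(n+2)]. *)
Lemma scattered_graph_packing (K : MetricSpace) (d m n N' : nat) (X : list K) (x0 : K) (s : R)
  (g f : K -> nat -> R) (y : nat * list nat -> K) :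
  ForallOrdPairs (fun p q => mdist K p q > / 2 ^ n) X ->
  spread K d m X x0 (/ 2 ^ (n + 2)) s g y ->
  scattered d (/ 2 ^ S n) (vertices X d m) y f ->
  is_packing_number (prod_dist K d) (graph f) (S n) N' ->
  (length X * m ^ d <= N' * 2)%nat.
Proof.
  intros HX [Hsp _] Hsc [_ Hmax].
  assert (H2 : 0 < / 2 ^ n) by (apply Rinv_0_lt_compat, pow_lt; lra).
  assert (E2 : / 2 ^ (n + 2) = / 2 ^ n / 4) by (rewrite pow_add; cbn; field; apply pow_nonzero; lra).
  assert (E1 : / 2 ^ S n = / 2 ^ n / 2) by (cbn; field; apply pow_nonzero; lra).
  rewrite ForallOrdPairs_nth with (x0 := x0) in HX.
  destruct (independent_sublist (close d (/ 2 ^ S n) y f) (vertices X d m)) as [L [HL [HLp HLl]]].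
  unfold scattered in Hsc. rewrite <- length_vertices.
  enough (HP : (length (map (fun v => (y v, f (y v))) L) <= N')%nat) by (rewrite length_map in HP; lia).
  apply (Hmax _ (x0, fun _ => 0)). apply is_packing_iff. split.
  - intros p Hp. apply in_map_iff in Hp as [v [<- _]]. reflexivity.
  - clear HLl. induction HLp as [|v L Hv HLp IH]; cbn [map]; constructor.
    + apply Forall_forall. intros p Hp. apply in_map_iff in Hp as [v' [<- Hv']].
      rewrite Forall_forall in Hv. specialize (Hv v' Hv').
      assert (I1 : In v (vertices X d m)) by (apply HL; left; auto).
      assert (I2 : In v' (vertices X d m)) by (apply HL; right; auto).
      destruct (Nat.eq_dec (fst v) (fst v')) as [E|E].
      * assert (Hk : exists k, (k < d)%nat /\ / 2 ^ S n < Rabs (f (y v) k - f (y v') k)).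
        { apply NNPP; intros Hno. apply Hv. split; [exact E|]. intros k Hk.
          apply Rnot_lt_le; intros Hlt. apply Hno; eauto. }
        destruct Hk as [k [Hk Hlt]].
        eapply Rlt_le_trans; [exact Hlt|].
        eapply Rle_trans; [apply (Rabs_le_eucl d k (vsub (f (y v)) (f (y v'))) Hk)|].
        apply (eucl_le_prod_dist K d (y v, f (y v)) (y v', f (y v'))).
      * apply Rlt_gt. eapply Rlt_le_trans; [|apply mdist_le_prod_dist]. cbn [fst].
        pose proof (Hsp v I1) as D1. pose proof (Hsp v' I2) as D2.
        apply In_vertices in I1 as [I1 _]. apply In_vertices in I2 as [I2 _].
        assert (DX : mdist K (nth (fst v) X x0) (nth (fst v') X x0) > / 2 ^ n).
        { destruct (Nat.lt_ge_cases (fst v) (fst v')).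
          - apply HX; lia.
          - rewrite Defs.dist_sym. apply HX; lia. }
        pose proof (Defs.dist_tri K (nth (fst v) X x0) (y v) (nth (fst v') X x0)) as T1.
        pose proof (Defs.dist_tri K (y v) (y v') (nth (fst v') X x0)) as T2.
        rewrite (Defs.dist_sym K (y v') (nth (fst v') X x0)) in T2.
        rewrite E1. rewrite E2 in D1, D2. cbn [fst]. lra.
    + apply IH. intros u Hu. apply HL; right; auto.
Qed.

(** * Isolated points and the choice of constants *)

(** Otherwise positions in [l] would inject [K] into [nat]. *)
Lemma exists_not_isolated (K : MetricSpace) (l : list K) :
  uncountable_space K -> (forall x, isolated K x -> In x l) -> exists x, ~ isolated K x.
Proof.
  intros HK Hl. apply NNPP; intros Hno. apply HK.
  assert (Hin : forall x, exists i, nth_error l i = Some x).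
  { intros x. apply In_nth_error, Hl, NNPP. intros Hx. apply Hno; eauto. }
  destruct (choice _ Hin) as [g Hg]. exists g. intros x y E.
  pose proof (Hg x) as Hx. rewrite E, Hg in Hx. congruence.
Qed.

(** Deleting the isolated points from a maximal packing loses at most [length l] of them, and
    [|X| + |l| <= |X| (|l| + 1)] once [X] is nonempty; [x0] stands in when nothing is left. *)
Lemma packing_avoiding_isolated (K : MetricSpace) (l : list K) (x0 : K) (n : nat) :
  (forall x, isolated K x -> In x l) -> ~ isolated K x0 ->
  exists X, (forall x, In x X -> ~ isolated K x) /\
    ForallOrdPairs (fun p q => mdist K p q > / 2 ^ n) X /\
    forall N, is_packing_number (mdist K) (fun _ => True) n N -> (N <= length X * S (length l))%nat.
Proof.
  intros Hl Hx0.
  destruct (classic (exists N, is_packing_number (mdist K) (fun _ => True) n N)) as [[N HN]|HN].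
  (* Without a packing number the last clause is vacuous, and a single non-isolated point will
     do. *)
  2:{ exists [x0]. split; [intros x [<-|[]]; exact Hx0|]. split; [repeat constructor|].
      intros N H. exfalso; eauto. }
  assert (HN' := HN). destruct HN' as [[L [z [HL HLN]]] _].
  apply is_packing_iff in HL as [_ HL].
  assert (G : exists X, (forall x, In x X -> ~ isolated K x /\ In x L) /\
     ForallOrdPairs (fun p q => mdist K p q > / 2 ^ n) X /\
     exists Y, NoDup Y /\ incl Y l /\ incl Y L /\ (length L = length X + length Y)%nat).
  { clear HLN. induction HL as [|a L Ha HL IH].
    - exists []. split; [intros x []|]. split; [constructor|]. exists []. repeat split; try easy. constructor.
    - destruct IH as [X [HX [HXp [Y [HY1 [HY2 [HY3 HY4]]]]]]]. rewrite Forall_forall in Ha.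
      destruct (classic (isolated K a)) as [Hia|Hia].
      + exists X. split; [intros x Hx; destruct (HX x Hx); split; [|right]; auto|]. split; [exact HXp|].
        exists (a :: Y). split; [|split; [|split]].
        * constructor; [|exact HY1]. intros Hin. specialize (Ha a (HY3 a Hin)).
          rewrite mdist_refl in Ha. assert (0 < / 2 ^ n) by (apply Rinv_0_lt_compat, pow_lt; lra). lra.
        * intros x [<-|Hx]; auto.
        * intros x [<-|Hx]; [left|right]; auto.
        * cbn. lia.
      + exists (a :: X). split; [|split].
        * intros x [<-|Hx]; [split; [|left]; auto|]. destruct (HX x Hx); split; [|right]; auto.
        * constructor; [|exact HXp]. apply Forall_forall. intros x Hx. apply Ha. now apply HX.
        * exists Y. repeat split; auto; [intros x Hx; right; auto|cbn; lia]. }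
  destruct G as [X [HX [HXp [Y [HY1 [HY2 [_ HY4]]]]]]].
  pose proof (NoDup_incl_length HY1 HY2) as HYl.
  destruct X as [|x X].
  - exists [x0]. split; [intros x [<-|[]]; exact Hx0|]. split; [repeat constructor|].
    intros N' HN'. rewrite (is_packing_number_unique _ _ _ _ _ HN' HN). cbn in *. lia.
  - exists (x :: X). split; [intros u Hu; now apply HX|]. split; [exact HXp|].
    intros N' HN'. rewrite (is_packing_number_unique _ _ _ _ _ HN' HN). cbn in *. nia.
Qed.

(** Makes [grid_size] positive from [n = 30] on. Since [30 + 2 = 2^5], the base case compares
    exponents, [2^27 <= 2^30]; the step rests on [(u + 1)^5 <= 2 u^5] for [u >= 32]. *)
Lemma pow2_dominates_pow5 (n : nat) : (30 <= n)%nat -> (4 * (n + 2) ^ 5 <= 2 ^ n)%nat.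
Proof.
  induction 1 as [|n Hn IH].
  { change (30 + 2)%nat with (2 ^ 5)%nat. rewrite <- Nat.pow_mul_r.
    change (4 * 2 ^ (5 * 5))%nat with (2 ^ 2 * 2 ^ (5 * 5))%nat.
    rewrite <- Nat.pow_add_r. apply Nat.pow_le_mono_r; lia. }
  assert (H : ((S n + 2) ^ 5 <= 2 * (n + 2) ^ 5)%nat).
  { replace (S n + 2)%nat with (S (n + 2)) by lia.
    assert (Hu : (32 <= n + 2)%nat) by lia. generalize dependent (n + 2)%nat. intros u _ Hu.
    cbn [Nat.pow]. 
    assert (32 * (u * (u * (u * u))) <= u * (u * (u * (u * u))))%nat by nia.
    assert (32 * (u * (u * u)) <= u * (u * (u * u)))%nat by nia.
    assert (32 * (u * u) <= u * (u * u))%nat by nia.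
    nia. }
  cbn [Nat.pow] in *. lia.
Qed.

(** The harmonic sum gives a failure bound of order [n / (2^n s_n)]; to make it [O(n^-2)] the mesh
    [s_n] is taken of order [n^3 / 2^n]. The height budget [1 / ((n + 1) (n + 2))] for [m_n s_n]
    then allows [m_n] of order [2^n / n^5], hence the fifth power. For small [n] the quotient is
    0. *)
Definition grid_size (n : nat) : nat := (2 ^ n / (4 * (n + 2) ^ 5))%nat.

(** The height budget [1 / ((n + 1) (n + 2))] divided by the unrounded quotient in [grid_size]. *)
Definition grid_step (n : nat) : R :=
  4 * (INR n + 2) ^ 5 / (2 ^ n * ((INR n + 1) * (INR n + 2))).

Lemma grid_step_pos (n : nat) : 0 < grid_step n.
Proof.
  pose proof (pos_INR n). assert (0 < 2 ^ n) by (apply pow_lt; lra).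
  assert (0 < (INR n + 2) ^ 5) by (apply pow_lt; lra).
  apply Rdiv_lt_0_compat; [lra|]. repeat apply Rmult_lt_0_compat; lra.
Qed.

Lemma INR_pow5 (n : nat) : INR (4 * (n + 2) ^ 5) = 4 * (INR n + 2) ^ 5.
Proof.
  rewrite mult_INR, pow_INR, plus_INR.
  replace (INR 4) with 4 by (cbn; ring). now replace (INR 2) with 2 by reflexivity.
Qed.

Lemma INR_pow2 (n : nat) : INR (2 ^ n) = 2 ^ n.
Proof. rewrite pow_INR. reflexivity. Qed.

Lemma grid_size_mul_step (n : nat) :
  INR (grid_size n) * grid_step n <= 1 / ((INR n + 1) * (INR n + 2)).
Proof.
  pose proof (pos_INR n). assert (0 < 2 ^ n) by (apply pow_lt; lra).
  assert (Hm : INR (grid_size n) * (4 * (INR n + 2) ^ 5) <= 2 ^ n).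
  { rewrite <- INR_pow5, <- mult_INR, <- INR_pow2. apply le_INR. unfold grid_size.
    rewrite Nat.mul_comm. apply Nat.Div0.mul_div_le. }
  unfold grid_step.
  replace (INR (grid_size n) * (4 * (INR n + 2) ^ 5 / (2 ^ n * ((INR n + 1) * (INR n + 2)))))
    with (INR (grid_size n) * (4 * (INR n + 2) ^ 5) * / 2 ^ n * / ((INR n + 1) * (INR n + 2)))
    by (field; lra).
  apply Rmult_le_compat_r; [left; apply Rinv_0_lt_compat; nra|].
  apply (Rmult_le_reg_r (2 ^ n)); [assumption|]. rewrite Rmult_assoc, Rinv_l by lra. lra.
Qed.

Lemma pow2_lt_grid_size_S (n : nat) : 2 ^ n <= INR (S (grid_size n)) * (4 * (INR n + 2) ^ 5).
Proof.
  rewrite <- INR_pow5, <- mult_INR, <- INR_pow2. apply le_INR. unfold grid_size.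
  assert (H : (0 < 4 * (n + 2) ^ 5)%nat).
  { apply Nat.mul_pos_pos; [lia|]. apply Nat.neq_0_lt_0, Nat.pow_nonzero; lia. }
  pose proof (Nat.div_mod (2 ^ n) (4 * (n + 2) ^ 5) ltac:(lia)).
  pose proof (Nat.mod_upper_bound (2 ^ n) (4 * (n + 2) ^ 5) ltac:(lia)). lia.
Qed.

(** The factor in front of [harm] simplifies to [(n + 1) / (n + 2)^4], and [harm] is at most [n + 1]
    because [grid_size n <= 2^n]; what remains is [(n + 1)^3 <= (n + 2)^3]. *)
Lemma grid_harm_le (n : nat) :
  2 * (4 * / 2 ^ S n / grid_step n) * harm (grid_size n) <= 1 / ((INR n + 1) * (INR n + 2)).
Proof.
  pose proof (pos_INR n). assert (0 < 2 ^ n) by (apply pow_lt; lra).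
  assert (Hh : harm (grid_size n) <= INR n + 1).
  { eapply Rle_trans; [|apply harm_pow2]. apply harm_le. unfold grid_size.
    apply Nat.Div0.div_le_upper_bound. 
    assert (0 < (n + 2) ^ 5)%nat by (apply Nat.neq_0_lt_0, Nat.pow_nonzero; lia). nia. }
  replace (2 * (4 * / 2 ^ S n / grid_step n))
    with ((INR n + 1) / (INR n + 2) ^ 4)
    by (unfold grid_step; cbn [pow]; field; repeat split; try apply pow_nonzero; lra).
  assert (H4 : 0 < (INR n + 2) ^ 4) by (apply pow_lt; lra).
  apply Rle_trans with ((INR n + 1) / (INR n + 2) ^ 4 * (INR n + 1)).
  { apply Rmult_le_compat_l; [|exact Hh]. apply Rmult_le_pos; [lra|left; now apply Rinv_0_lt_compat]. }
  apply (Rmult_le_reg_r ((INR n + 1) * (INR n + 2) * (INR n + 2) ^ 4)); [repeat apply Rmult_lt_0_compat; lra|].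
  replace ((INR n + 1) / (INR n + 2) ^ 4 * (INR n + 1) * ((INR n + 1) * (INR n + 2) * (INR n + 2) ^ 4))
    with ((INR n + 1) ^ 3 * (INR n + 2)) by (field; lra).
  replace (1 / ((INR n + 1) * (INR n + 2)) * ((INR n + 1) * (INR n + 2) * (INR n + 2) ^ 4))
    with ((INR n + 2) ^ 3 * (INR n + 2)) by (field; lra).
  apply Rmult_le_compat_r; [lra|]. apply pow_incr. lra.
Qed.

(** The deterministic half: here [f] is fixed and known to be scattered at all large scales. The
    upper estimate holds at every scale, the lower one from [n0 + 30] on. *)
Lemma graph_box_dims_of_scattered (K : MetricSpace) (d q : nat) (f : K -> nat -> R)
  (x0 : K) (X : nat -> list K) (g : K -> nat -> R) (y : nat -> nat * list nat -> K) :
  compact_space K -> (1 <= d)%nat -> inC K d f ->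
  (forall n, ForallOrdPairs (fun p q => mdist K p q > / 2 ^ n) (X n)) ->
  (forall n N, is_packing_number (mdist K) (fun _ => True) n N -> (N <= length (X n) * S q)%nat) ->
  (forall n, spread K d (grid_size n) (X n) x0 (/ 2 ^ (n + 2)) (grid_step n) g (y n)) ->
  (exists n0, forall n, (n0 <= n)%nat ->
     scattered d (/ 2 ^ S n) (vertices (X n) d (grid_size n)) (y n) f) ->
  forall N, (forall n, is_packing_number (mdist K) (fun _ => True) n (N n)) ->
  exists N', (forall n, is_packing_number (prod_dist K d) (graph f) n (N' n)) /\
    asymptotically_shifted (box_ratio N) (box_ratio N') (INR d).
Proof.
  intros HK Hd Hf HX HXN Hsp [n0 Hsc] N HN.
  destruct (inC_bounded K d f HK Hf) as [M [HM HfM]].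
  assert (Hup : forall n l z, is_packing (prod_dist K d) (graph f) (/ 2 ^ n) l z ->
     (length l <= N (n + 2) * (4 * M * d * 2 ^ n) ^ d)%nat).
  { intros n l z. apply (graph_packing_le K d f M n _ l z HM Hd HfM). apply HN. }
  destruct (choice _ (fun n => is_packing_number_exists _ _ n _ (x0, f x0) (Hup n))) as [N' HN'].
  exists N'. split; [exact HN'|].
  (* [S (2 q + 1) = 2 (q + 1)]: a factor 2 for the dropped vertices and [q + 1] for the isolated
     points. *)
  apply (asymptotically_shifted_box_ratio N N' d (2 * q + 1) (4 * M * d) grid_size).
  - intros n. destruct (HN n) as [_ H]. apply (H [x0] x0). apply is_packing_iff.
    split; [auto|repeat constructor].
  - intros n. destruct (HN' n) as [_ H]. apply (H [(x0, f x0)] (x0, f x0)). apply is_packing_iff.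
    split; [intros p [<-|[]]; reflexivity|repeat constructor].
  - nia.
  - apply pow2_lt_grid_size_S.
  - exists (n0 + 30)%nat. intros n Hn. split.
    + unfold grid_size. apply Nat.div_le_lower_bound.
      * assert ((n + 2) ^ 5 <> 0)%nat by (apply Nat.pow_nonzero; lia). lia.
      * rewrite Nat.mul_1_r. apply pow2_dominates_pow5. lia.
    + pose proof (scattered_graph_packing K d (grid_size n) n (N' (S n)) (X n) x0 (grid_step n) g f (y n)
        (HX n) (Hsp n) (Hsc n ltac:(lia)) (HN' (S n))) as H.
      pose proof (HXN n _ (HN n)) as H'.
      apply Nat.le_trans with (length (X n) * S q * grid_size n ^ d)%nat.
      * now apply Nat.mul_le_mono_r.
      * replace (length (X n) * S q * grid_size n ^ d)%nat with (length (X n) * grid_size n ^ d * S q)%nat by ring.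
        replace (N' (S n) * S (2 * q + 1))%nat with (N' (S n) * 2 * S q)%nat by ring.
        now apply Nat.mul_le_mono_r.
  - intros n. destruct (HN' n) as [[l [z [Hl <-]]] _]. now apply (Hup n l z).
Qed.


(** * Independent uniform variables from product measures *)

Module UniformProbe.
Import all_boot all_order all_algebra all_classical all_reals all_analysis
  measurable_realfun Rstruct Rstruct_topology.
Import Order.TTheory GRing.Theory Num.Theory numFieldNormedType.Exports.
Local Open Scope classical_set_scope.
Local Open Scope ring_scope.

Local Notation R := Rdefinitions.R.

Lemma sum_f_R0_big (u : nat -> R) n : sum_f_R0 u n = \sum_(0 <= i < n.+1) u i.
Proof.
elim: n => [|n IH] /=; first by rewrite big_nat1.
by rewrite big_nat_recr //= IH.
Qed.

Lemma fine_cvg_eps (K : realType) (u : nat -> \bar K) (l : K) :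
  u @ \oo --> l%:E ->
  forall e, 0 < e -> exists N, forall n, (N <= n)%N -> `|l - fine (u n)| < e.
Proof.
move=> /fine_cvgP [_ /cvgrPdist_lt H] e e0.
by have [N _ HN] := H e e0; exists N.
Qed.

Lemma fine_measure_sigma d (T : measurableType d) (P : probability T R)
    (A : nat -> set T) :
  (forall n, measurable (A n)) ->
  (forall i j w, i <> j -> A i w -> A j w -> False) ->
  infinite_sum (fun n => fine (P (A n))) (fine (P (fun w => exists n, A n w))).
Proof.
move=> mA dA.
have -> : (fun w => exists n, A n w) = \bigcup_n A n.
  by apply/seteqP; split => w [n] //; [exists n | move=> _; exists n].
have tA : trivIset setT A.
  apply/trivIsetP => i j _ _ ij; apply/seteqP; split => // w [Ai Aj].
  by case: (dA i j w _ Ai Aj) => /eqP; exact/negP.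
have mU : measurable (\bigcup_n A n) by exact: bigcup_measurable.
have H0 : (fun n => \sum_(0 <= i < n) P (A i))%E @ \oo --> (fine (P (\bigcup_n A n)))%:E.
  by rewrite fineK; [exact: measure_semi_sigma_additive | exact: fin_num_measure].
have H := fine_cvg_eps R _ _ H0.
move=> e /RltP e0; have [N HN] := H _ e0.
exists N => n nN; apply/RltP; rewrite /R_dist RabsE RminusE distrC sum_f_R0_big.
have := HN n.+1 (leq_trans (introT ssrnat.leP nN) (leqnSn n)).
by rewrite -sum_fine // => i _; exact: fin_num_measure.
Qed.

(** The density is at most 1. Equality can fail, as [[a, b]] may reach outside [[0, 1]]. *)
Lemma uniform_itv_le (K : realType) (a b : K) : a <= b ->
  fine (uniform_prob (@ltr01 K) `[a, b]) <= b - a.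
Proof.
move=> ab.
have h : (uniform_prob (@ltr01 K) `[a, b] <= (b - a)%:E)%E.
  have mI : measurable (`[a, b] : set (measurableTypeR K)) by exact: measurable_itv.
  rewrite /uniform_prob.
  apply: (@le_trans _ _ (\int[lebesgue_measure]_(x in `[a, b]) (1%:E))%E).
    apply: ge0_le_integral => //=.
    - by move=> x _; rewrite lee_fin uniform_pdf_ge0.
    - by apply/measurable_EFinP/measurable_funTS; exact: measurable_uniform_pdf.
    - by move=> x _; rewrite lee_fin /uniform_pdf; case: ifP => //; rewrite subr0 invr1.
  rewrite integral_cst //= mul1e lebesgue_measure_itv /= lte_fin.
  by case: ltP => // _; rewrite lee_fin subr_ge0.
rewrite -lee_fin fineK //; exact: fin_num_measure.
Qed.

(** Closed with [Defined], because later simplification must reduce [event] and [pr] to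
    measurability and [fine (P _)]. *)
Definition of_probability d (T : measurableType d) (P : probability T R) : prob_space.
Proof.
refine (@Build_prob_space T (@measurable d T) (fun A => fine (P A)) _ _ _ _ _ _).
- exact: measurableT.
- by move=> A mA; exact: measurableC.
- move=> A mA.
  have -> : (fun w => exists n, A n w) = \bigcup_n A n.
    by apply/seteqP; split => w [n] //; [exists n | move=> _; exists n].
  exact: bigcup_measurable.
- by move=> A mA; apply/RleP; exact: fine_ge0.
- by rewrite probability_setT.
- exact: fine_measure_sigma.
Defined.

(** Stated as a box inequality rather than as independence with uniform marginals, since this is the
    form that [pr_close_le] consumes; a coordinate outside [use] is free and contributes the factor
    1. *)
Definition independent_uniforms d (T : measurableType d) (P : probability T R) (n : nat) (t : nat -> T -> R) :=
  (forall k, measurable_fun setT (t k : T -> measurableTypeR R)) /\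
  forall (use : nat -> bool) a b, (forall k, a k <= b k) ->
     fine (P (fun w => forall k, (k < n)%coq_nat -> use k = true -> a k <= t k w /\ t k w <= b k))
     <= prodR n (fun k => if use k then b k - a k else 1).

(** On the product with one more uniform measure [U], variable [n] reads the second component and
    the earlier ones the first. A box is then a measurable rectangle, whose measure is a product. In
    dimension 0 the empty product is 1 and constant variables suffice. *)
Lemma independent_uniforms_exist n :
  exists d (T : measurableType d) (P : probability T R) t, independent_uniforms d T P n t.
Proof.
elim: n => [|n [d [T [P [t [mt Pt]]]]]].
  pose U : probability _ R := uniform_prob (@ltr01 R).
  exists _, _, U, (fun _ _ => 0); split.
    by move=> k; exact: measurable_cst.
  move=> use a b ab /=.
  rewrite (_ : (fun w => _) = setT); first by rewrite probability_setT.
  by apply/seteqP; split => // w _ k /ssrnat.ltP.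
pose U : probability _ R := uniform_prob (@ltr01 R).
exists _, _, (P \x U)%E, (fun k w => if k == n then w.2 else t k w.1); split.
  move=> k; case: (k == n); first exact: measurable_snd.
  by apply: measurableT_comp; [exact: mt | exact: measurable_fst].
move=> use a b ab /=.
pose A := fun w => forall k, (k < n)%coq_nat -> use k = true -> a k <= t k w /\ t k w <= b k.
(* The whole line when coordinate [n] is free, which gives the factor 1. *)
pose B : set (measurableTypeR R) := if use n then `[a n, b n]%classic else setT.
rewrite (_ : (fun w => _) = A `*` B); last first.
  apply/seteqP; split => -[w x] /= h.
    split => /=.
      move=> k kn uk; have := h k (ltac:(lia)) uk.
      by case: eqP => // ek; lia.
    rewrite /B; case un : (use n) => //=.
    by have := h n (ltac:(lia)) un; rewrite eqxx in_itv /= => -[-> ->].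
  move: h => [hA hB] k kn uk; case: eqP => [ek|/eqP ek].
    by subst k; move: hB; rewrite /B uk /= in_itv /= => /andP[].
  apply: hA => //; have : k <> n by exact/eqP.
  lia.
have mA : measurable A.
  rewrite (_ : A = \bigcap_(k in [set k | (k < n)%coq_nat /\ use k = true]) (t k @^-1` `[a k, b k])).
    apply: bigcap_measurableType => k _; rewrite -[X in measurable X]setTI.
    exact: mt.
  apply/seteqP; split => w h k /=.
    by case=> kn uk; have [h1 h2] := h k kn uk; rewrite in_itv /= h1 h2.
  by move=> kn uk; have := h k (conj kn uk); rewrite /= in_itv /= => /andP.
have mB : measurable B by rewrite /B; case: ifP => _; [exact: measurable_itv | exact: measurableT].
rewrite product_measure1E // fineM; [|exact: fin_num_measure|exact: fin_num_measure].
apply: ler_pM.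
- exact: fine_ge0.
- exact: fine_ge0.
- exact: Pt.
- rewrite /B; case: ifP => _; first exact: (uniform_itv_le R).
  have U1 : fine (U setT) = 1 by rewrite probability_setT.
  by rewrite le_eqVlt; apply/orP; left; apply/eqP; exact: U1.
Qed.
Local Close Scope ring_scope.
Local Open Scope R_scope.

Lemma uniform_probe (d : nat) :
  exists (O : prob_space) (t : nat -> O -> R),
    (forall k c, event O (fun w => t k w <= c)) /\
    forall (use : nat -> bool) (a b : nat -> R), (forall k, a k <= b k) ->
      pr O (fun w => forall k, (k < d)%coq_nat -> use k = true -> a k <= t k w <= b k)
      <= prodR d (fun k => if use k then b k - a k else 1).
Proof.
have [e [T [P [t [mt Pt]]]]] := independent_uniforms_exist d.
exists (of_probability e T P), t; split.
  move=> k c /=.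
  rewrite (_ : (fun w => _) = (t k @^-1` `]-oo, c])%classic).
    by rewrite -[X in measurable X]setTI; apply: mt => //; exact: measurable_itv.
  by apply/seteqP; split => w /=; rewrite in_itv /= => /RleP.
move=> use a b ab; apply/RleP => /=.
apply: le_trans (Pt use a b _); last by move=> k; apply/RleP; exact: ab.
rewrite le_eqVlt; apply/orP; left; apply/eqP; congr (fine (P _)).
apply/funext => w; apply/propext; split => h k kd uk; have [h1 h2] := h k kd uk.
  by split; apply/RleP.
by split; apply/RleP.
Qed.
End UniformProbe.

Theorem theorem1p8 (K : MetricSpace) (d : nat) :
  compact_space K -> uncountable_space K -> finitely_many_isolated K -> (1 <= d)%nat ->
  prevalently K d (fun f =>
    (forall v, lower_box_dim (mdist K) (fun _ => True) v ->
               lower_box_dim (prod_dist K d) (graph f) (Rbar_plus_nat v d)) /\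
    (forall v, upper_box_dim (mdist K) (fun _ => True) v ->
               upper_box_dim (prod_dist K d) (graph f) (Rbar_plus_nat v d))).
Proof.
  intros HK Hunc [l Hl] Hd.
  destruct (exists_not_isolated K l Hunc Hl) as [x0 Hx0].
  destruct (choice _ (fun n => packing_avoiding_isolated K l x0 n Hl Hx0)) as [X HX].
  destruct (spread_all_scales K d x0 X grid_size (fun n => / 2 ^ (n + 2)) grid_step)
    as [g [Hg [Hg01 Hy]]].
  { intros n. apply HX. }
  { intros n. apply Rinv_0_lt_compat, pow_lt; lra. }
  { exact grid_step_pos. }
  { exact grid_size_mul_step. }
  destruct (choice _ Hy) as [y Hsp].
  destruct (UniformProbe.uniform_probe d) as [O [t [Ht Hbox]]].
  set (good := fun n f => scattered d (/ 2 ^ S n) (vertices (X n) d (grid_size n)) (y n) f).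
  (* The property itself serves as the prevalent set. *)
  match goal with |- prevalently K d ?P => exists P end.
  split; [|auto].
  (* The Borel cover of the exceptional set: failure to be scattered at infinitely many scales. *)
  exists (fun f => forall N, exists n, (N <= n)%nat /\ ~ good n f).
  exists (fun B => pr O (fun w => B (scale_coords g (fun i => t i w)))).
  split; [|split; [|split]].
  - apply (borel_ext K d (fun f => ~ exists N, ~ exists k, ~ good (N + k)%nat f)).
    + apply borel_compl, borel_union. intros N. apply borel_compl, borel_union. intros k.
      apply borel_compl, borel_open, supopen_scattered.
    + intros f _. split.
      * intros H N. apply NNPP; intros Hno. apply H. exists N. intros [k Hk]. apply Hno.
        exists (N + k)%nat. split; [lia|exact Hk].
      * intros H [N HN]. destruct (H N) as [n [Hn Hn']]. apply HN. exists (n - N)%nat.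
        now replace (N + (n - N))%nat with n by lia.
  - intros f Hf [_ HnP]. apply NNPP; intros Hno. apply HnP.
    assert (Hev : exists n0, forall n, (n0 <= n)%nat -> good n f).
    { apply not_all_ex_not in Hno as [n0 Hn0]. exists n0. intros n Hn. apply NNPP; intros H.
      apply Hn0; eauto. }
    pose proof (graph_box_dims_of_scattered K d (length l) f x0 X g y HK Hd Hf
      (fun n => proj1 (proj2 (HX n))) (fun n => proj2 (proj2 (HX n))) Hsp Hev) as HD.
    split; intros v [N [HN Hlim]]; destruct (HD N HN) as [N' [HN' Has]]; exists N'; split; auto.
    + now apply (is_liminf_shifted (box_ratio N)).
    + now apply (is_limsup_shifted (box_ratio N)).
  - now apply pushforward_borel_prob_measure.
  - intros x Hx. unfold translate.
    (* The translate [x] is arbitrary: the bound of [pr_not_scattered_le] with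
       [z = 1 / ((n + 1) (n + 2))] does not involve it. *)
    apply (pr_infinitely_often O (fun n w => ~ good n (fsub (scale_coords g (fun i => t i w)) x))
             (2 * (2 ^ d - 1))).
    + assert (1 <= 2 ^ d) by (apply pow_R1_Rle; lra). lra.
    + intros n. apply event_compl. now apply event_scattered.
    + intros n. eapply Rle_trans.
      * apply (pr_not_scattered_le K d (grid_size n) (X n) x0 (/ 2 ^ (n + 2)) (grid_step n) (/ 2 ^ S n)
                 (1 / ((INR n + 1) * (INR n + 2))) O t g x (y n) Ht Hbox (Hsp n) (grid_step_pos n)).
        -- left. apply Rinv_0_lt_compat, pow_lt; lra.
        -- apply grid_harm_le.
        -- pose proof (pos_INR n). assert (1 <= (INR n + 1) * (INR n + 2)) by nra.
           split; [left; apply Rdiv_lt_0_compat; lra|].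
           apply (Rmult_le_reg_r ((INR n + 1) * (INR n + 2))); [lra|].
           unfold Rdiv. rewrite Rmult_assoc, Rinv_l by lra. lra.
      * pose proof (pos_INR n). right. field. lra.
Qed.
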